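(* Let $T>0$ and $c_0>0$, and let $\lambda,\eta:[0,T]\to[c_0,+\infty[$ be absolutely continuous functions. Let $x_0,y_0\in\operatorname{dom}\partial\varphi$, $v_0\in\partial\varphi(x_0)$, $w_0\in\partial\varphi(y_0)$, and let $(x,v),(y,w):[0,T]\to H\times H$ be the respective strong solutions of $$\lambda\dot x+\dot v+v+\nabla\psi(x)=0,\quad v\in\partial\varphi(x),\quad x(0)=x_0,\quad v(0)=v_0,$$ $$\eta\dot y+\dot w+w+\nabla\psi(y)=0,\quad w\in\partial\varphi(y),\quad y(0)=y_0,\quad w(0)=w_0.$$ Define $\theta:[0,T]\to\mathbb{R}$ by $$\theta(t)=\sqrt{c_0^2\|x(t)-y(t)\|^2+\|v(t)-w(t)\|^2}.$$ Then $$\|\theta\|_{L^\infty([0,T])}\le\left[\frac{\lambda(0)+\eta(0)}{2}\|x_0-y_0\|+\|v_0-w_0\|+\frac{C}{2}\|\lambda-\eta\|_{L^1([0,T])}\right]\exp\left(\frac{\|\dot\lambda+\dot\eta\|_{L^1([0,T])}}{2c_0}+T\Big(1+\frac{L_\psi}{c_0}\Big)\right),$$ with $$C=\frac{\|v_0\|+\|w_0\|}{c_0}+\frac{1+\sqrt{2T}}{c_0}\big(\|\nabla\psi(x_0)\|+\|\nabla\psi(y_0)\|\big)+\frac{(\sqrt2\,T+\sqrt T)L_\psi}{c_0^{3/2}}\left(\Big((\varphi+\psi)(x_0)-\inf_H(\varphi+\psi)\Big)^{1/2}+\Big((\varphi+\psi)(y_0)-\inf_H(\varphi+\psi)\Big)^{1/2}\right).$$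 In particular, if $x_0=y_0$ and $v_0=w_0$, then $$\|\theta\|_{L^\infty([0,T])}\le\frac{C}{2}\|\lambda-\eta\|_{L^1([0,T])}\exp\left(\frac{\|\dot\lambda+\dot\eta\|_{L^1([0,T])}}{2c_0}+T\Big(1+\frac{L_\psi}{c_0}\Big)\right),$$ with $$C=\frac{2\|v_0\|}{c_0}+2\,\frac{1+\sqrt{2T}}{c_0}\|\nabla\psi(x_0)\|+2\,\frac{(\sqrt2\,T+\sqrt T)L_\psi}{c_0^{3/2}}\Big((\varphi+\psi)(x_0)-\inf_H(\varphi+\psi)\Big)^{1/2}.$$
   Context: $H$ is a real Hilbert space with scalar product $\langle\cdot,\cdot\rangle$ and norm $\|\cdot\|$. The function $\varphi:H\to\mathbb{R}\cup\{+\infty\}$ is convex, lower semicontinuous and proper, with convex subdifferential $\partial\varphi$ and $\operatorname{dom}\partial\varphi=\{x\in H:\partial\varphi(x)\neq\emptyset\}$. The function $\psi:H\to\mathbb{R}$ is convex and differentiable, and $\nabla\psi$ is $L_\psi$-Lipschitz continuous on $H$. The function $\varphi+\psi$ is bounded from below on $H$. A strong solution on $[0,T]$ of such a differential inclusion (with coefficient $\lambda$) is a pair $(x,v)$ of absolutely continuous functions $x,v:[0,T]\to H$ such that $v(t)\in\partial\varphi(x(t))$ for all $t\in[0,T]$, the differential equation $\lambda(t)\dot x(t)+\dot v(t)+v(t)+\nabla\psi(x(t))=0$ holds for almost every $t\in[0,T]$, and the initial conditions hold (likewise for $(y,w)$ with coefficient $\eta$). *)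

(* Defs.v *)
From HB Require Import structures.
From mathcomp Require Import all_boot all_order all_algebra.
From mathcomp Require Import all_classical all_reals all_analysis.

Set Implicit Arguments.
Unset Strict Implicit.
Unset Printing Implicit Defensive.

Import Order.TTheory GRing.Theory Num.Theory.
Import numFieldNormedType.Exports.

Local Open Scope classical_set_scope.
Local Open Scope ring_scope.

(* A real Hilbert space is a complete normed module H together with a symmetric
   positive definite bilinear form dot that induces its norm. *)
Definition induces_norm (R : realType) (H : completeNormedModType R)
    (dot : {dot H for idfun}) : Prop :=
  forall u : H, `|u| = Num.sqrt (dot u u).

Definition proper_fun (R : realType) (T : Type) (phi : T -> \bar R) : Prop :=
  (forall x, phi x != -oo%E) /\ (exists x, (phi x < +oo)%E).

(* The library's convex_function only covers real-valued functions. With values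
   in ]-oo, +oo] and the convention 0 * +oo = 0, the cases t = 0 and t = 1 are
   trivially true. *)
Definition econvex (R : realType) (V : lmodType R) (phi : V -> \bar R) : Prop :=
  forall (t : R) (x y : V), 0 <= t <= 1 ->
    (phi (t *: x + (1 - t) *: y)%R <= t%:E * phi x + (1 - t)%R%:E * phi y)%E.

(* For proper phi this set is empty wherever phi x = +oo. *)
Definition subdiff (R : realType) (H : completeNormedModType R)
    (dot : {dot H for idfun}) (phi : H -> \bar R) (x : H) : set H :=
  [set v | forall y : H, (phi x + (dot v (y - x)%R)%:E <= phi y)%E].

Definition dom_subdiff (R : realType) (H : completeNormedModType R)
    (dot : {dot H for idfun}) (phi : H -> \bar R) : set H :=
  [set x | subdiff dot phi x !=set0].

(* psi is Frechet differentiable everywhere and dpsi is its gradient, i.e. the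
   representative of the differential with respect to dot. *)
Definition is_gradient (R : realType) (H : completeNormedModType R)
    (dot : {dot H for idfun}) (psi : H -> R) (dpsi : H -> H) : Prop :=
  forall x : H, differentiable psi x /\
    (forall h : H, 'd psi x h = dot (dpsi x) h).

Definition esum_fun (R : realType) (T : Type) (phi : T -> \bar R) (psi : T -> R)
  : T -> \bar R := fun z => (phi z + (psi z)%:E)%E.

Definition bounded_below (R : realType) (T : Type) (f : T -> \bar R) : Prop :=
  exists m : R, forall z, (m%:E <= f z)%E.

(* f z - inf f, as a real number: fine only discards the extended reals, and
   the difference is finite when f is bounded below and f z < +oo. *)
Definition energy_gap (R : realType) (T : Type) (f : T -> \bar R) (z : T) : R :=
  fine (f z - ereal_inf (range f))%E.

Definition absolutely_continuous (R : realType) (V : normedModType R)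
    (a b : R) (f : R -> V) : Prop :=
  forall e : R, 0 < e -> exists2 d : R, 0 < d &
    forall (n : nat) (I : 'I_n -> R * R),
      (forall i, [/\ a <= (I i).1, (I i).1 <= (I i).2 & (I i).2 <= b]) ->
      trivIset setT (fun i => `](I i).1, (I i).2[%classic) ->
      \sum_(i < n) ((I i).2 - (I i).1) < d ->
      \sum_(i < n) `|f (I i).2 - f (I i).1| < e.

(* Functions on [0, T] are represented by functions on R of which only the
   values on [0, T] are constrained. The derivatives are two-sided; the
   endpoints 0 and T, where they could see outside values, form a null set. *)
Record strong_solution (R : realType) (H : completeNormedModType R)
    (dot : {dot H for idfun}) (phi : H -> \bar R) (dpsi : H -> H)
    (T : R) (lambda : R -> R) (x0 v0 : H) (x v : R -> H) : Prop := {
  strong_solution_acx : absolutely_continuous 0 T x ;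
  strong_solution_acv : absolutely_continuous 0 T v ;
  strong_solution_incl : forall t : R, t \in `[0, T] -> subdiff dot phi (x t) (v t) ;
  strong_solution_ode : {ae lebesgue_measure, forall t : R, t \in `[0, T] ->
    [/\ derivable x t 1, derivable v t 1 &
        lambda t *: x^`()%classic t + v^`()%classic t + v t + dpsi (x t) = 0]} ;
  strong_solution_x0 : x 0 = x0 ;
  strong_solution_v0 : v 0 = v0
}.

(* The norm of L^p([0, T]), computed on the extension by zero. *)
Definition Lnorm_itv (R : realType) (T : R) (p : \bar R) (f : R -> R) : \bar R :=
  Lnorm (@lebesgue_measure R) p ((EFin \o f) \_ `[0, T]%classic).

(* Main.v *)
From HB Require Import structures.
Require Import Defs.
From mathcomp Require Import all_boot all_order all_algebra.
From mathcomp Require Import all_classical all_reals all_analysis.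
From mathcomp Require Import interval_inference measurable_realfun lra ring.
Import Order.TTheory GRing.Theory Num.Theory.
Import numFieldNormedType.Exports.
Local Open Scope classical_set_scope.
Local Open Scope ring_scope.

(** Subtract the two equations and write a = x - y, b = v - w, and mu =
    (lambda + eta) / 2. Since
      lambda x' - eta y' = mu a' + ((lambda - eta) / 2) (x' + y'),
    the vector z = mu a + b satisfies, almost everywhere,
      z' = mu' a - ((lambda - eta) / 2) (x' + y') - b
           - (grad psi x - grad psi y).
    Monotonicity of the subdifferential gives <a, b> >= 0, hence |z|^2 >=
    mu^2 |a|^2 + |b|^2 >= theta^2. Thus theta, c0 |a| and |b| are all at
    most |z|, and
      |z|' <= (|mu'| / c0 + 1 + L / c0) |z| + (|lambda - eta| / 2) (|x'| + |y'|)
    ([norm_derive_le]). Gronwall's lemma ([ac_gronwall]) concludes once |x'|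
    and |y'| are known to be bounded; C is the sum of the two bounds.

    The bound on |x'| ([velocity_bound]) comes from three facts.
    Monotonicity gives <x', v'> >= 0, so the equation yields c0 |x'| <= |v +
    grad psi x|. The energy phi + psi decreases along x at rate at least c0
    |x'|^2, so x stays within sqrt (T gap / c0) of x0
    ([displacement_bound]), which controls grad psi x. Testing the equation
    against v' then controls v ([multiplier_bound]).

    All these differential inequalities hold only almost everywhere, between
    absolutely continuous functions, so the proof rests on Lebesgue's
    fundamental theorem of calculus: a real absolutely continuous f is the
    integral of a density h ([ac_density]), and f' = h almost everywhere
    ([density_derivable]). The density is obtained from the total variation
    V of f, which is again absolutely continuous ([ac_total_variation]), so
    that V and V - f are nondecreasing and absolutely continuous; the
    Lebesgue-Stieltjes measure of such a function is dominated by the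
    Lebesgue measure ([lebesgue_stieltjes_dominates]) and has a
    Radon-Nikodym derivative.

    The exponent of Gronwall's lemma uses the total variation of lambda +
    eta in place of the integral of |lambda' + eta'|: it is absolutely
    continuous, its derivative bounds |lambda' + eta'|, and at time T it is
    at most that integral ([ac_total_variation_le]). *)

Set Implicit Arguments.
Unset Strict Implicit.
Unset Printing Implicit Defensive.

(** * Absolutely continuous functions *)

(** The one closure property from which those of sums, products and norms
    follow. *)
Lemma ac_dominated (R : realType) (V1 V2 V : normedModType R) (a b M : R)
    (f1 : R -> V1) (f2 : R -> V2) (g : R -> V) :
  absolutely_continuous a b f1 -> absolutely_continuous a b f2 -> 0 <= M ->
  (forall s t, a <= s -> s <= t -> t <= b ->
    `|g t - g s| <= M * (`|f1 t - f1 s| + `|f2 t - f2 s|)) ->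
  absolutely_continuous a b g.
Proof.
move=> ac1 ac2 M0 dom e e0.
have M1 : 0 < M + 1 by rewrite ltr_wpDl.
have e1 : 0 < e / (M + 1) / 2 by rewrite !divr_gt0.
have [d1 d10 H1] := ac1 _ e1; have [d2 d20 H2] := ac2 _ e1.
exists (Num.min d1 d2) => [|n I Iab tI]; first by rewrite lt_min d10.
rewrite lt_min => /andP[/(H1 _ _ Iab tI) {}H1 /(H2 _ _ Iab tI) {}H2].
apply: (@le_lt_trans _ _ ((M + 1) * (\sum_(i < n) `|f1 (I i).2 - f1 (I i).1|
   + \sum_(i < n) `|f2 (I i).2 - f2 (I i).1|))).
  rewrite -big_split/= mulr_sumr; apply: ler_sum => i _.
  have [? ? ?] := Iab i.
  by apply: (le_trans (dom _ _ _ _ _)) => //; rewrite ler_wpM2r ?addr_ge0// lerDl.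
by rewrite mulrC -ltr_pdivlMr// (splitr (e / _)) ltrD.
Qed.

Lemma ac_lipschitz (R : realType) (V : normedModType R) (a b M : R)
    (g : R -> V) : 0 <= M ->
  (forall s t, a <= s -> s <= t -> t <= b -> `|g t - g s| <= M * (t - s)) ->
  absolutely_continuous a b g.
Proof.
move=> M0 dom.
have acid : absolutely_continuous a b (fun t : R => t : R^o).
  move=> e e0; exists e => // n I Iab _; apply: le_lt_trans.
  apply: ler_sum => i _; have [_ ? _] := Iab i.
  by rewrite ger0_norm // subr_ge0.
apply: (ac_dominated acid acid M0) => s t sa st tb.
apply: (le_trans (dom _ _ _ _ _)) => //; rewrite ler_wpM2l//.
by rewrite (ger0_norm (_ : 0 <= t - s)) ?subr_ge0// lerDl subr_ge0.
Qed.

Lemma ac_norm (R : realType) (V : normedModType R) (a b : R) (f : R -> V) :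
  absolutely_continuous a b f -> absolutely_continuous a b (fun t => `|f t| : R^o).
Proof.
move=> acf; apply: (ac_dominated acf acf ler01) => s t _ _ _.
by rewrite mul1r (le_trans (ler_dist_dist _ _))// lerDl.
Qed.

Lemma acB (R : realType) (V : normedModType R) (a b : R) (f g : R -> V) :
  absolutely_continuous a b f -> absolutely_continuous a b g ->
  absolutely_continuous a b (fun t => f t - g t).
Proof.
move=> acf acg; apply: (ac_dominated acf acg ler01) => s t _ _ _.
rewrite mul1r; have -> : f t - g t - (f s - g s) = (f t - f s) - (g t - g s).
  by rewrite !opprB addrACA [RHS]addrACA (addrC (- g t)).
exact: ler_normB.
Qed.

Lemma acD (R : realType) (V : normedModType R) (a b : R) (f g : R -> V) :
  absolutely_continuous a b f -> absolutely_continuous a b g ->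
  absolutely_continuous a b (fun t => f t + g t).
Proof.
move=> acf acg; apply: (ac_dominated acf acg ler01) => s t _ _ _.
by rewrite mul1r opprD addrACA ler_normD.
Qed.

Lemma ac_subitv (R : realType) (V : normedModType R) (a b c d : R) (f : R -> V) :
  a <= c -> d <= b ->
  absolutely_continuous a b f -> absolutely_continuous c d f.
Proof.
move=> ac db acf e /acf[r r0 H]; exists r => // n I Icd; apply: H => i.
by have [? ? ?] := Icd i; split => //; [exact: le_trans ac _|exact: le_trans db].
Qed.

(** * Total variation *)

(** Lists make it possible to cut one interval of a family into pieces, in
    place; the order condition is symmetric, so the list need not be sorted. *)
Definition nonoverlapping (R : realType) (a b : R) (s : seq (R * R)) : bool :=
  all (fun p => [&& a <= p.1, p.1 <= p.2 & p.2 <= b]) s &&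
  pairwise (fun p q => (p.2 <= q.1) || (q.2 <= p.1)) s.

Lemma ac_seq (R : realType) (V : normedModType R) (a b : R) (f : R -> V) (e : R) :
  absolutely_continuous a b f -> 0 < e -> exists2 d : R, 0 < d &
    forall s, nonoverlapping a b s -> \sum_(p <- s) (p.2 - p.1) < d ->
    \sum_(p <- s) `|f p.2 - f p.1| < e.
Proof.
move=> acf /acf[d d0 H]; exists d => // s /andP[/all_nthP-/(_ (0, 0)) abs dis].
rewrite !(big_nth (0, 0)) !big_mkord => sd.
apply: H sd => [i|]; first by have /and3P[] := abs _ (ltn_ord i).
have lt_dis (i j : nat) : (i < j)%N -> (j < size s)%N ->
  [set` `](nth (0,0) s i).1, (nth (0,0) s i).2[] `&`
  [set` `](nth (0,0) s j).1, (nth (0,0) s j).2[] = set0.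
  move=> ij js; have /pairwiseP-/(_ (0, 0) i j) := dis.
  rewrite !inE => /(_ (ltn_trans ij js) js ij) ne.
  rewrite -subset0 => z/= []; rewrite !in_itv/= => /andP[z1 z2] /andP[z3 z4].
  by case/orP: ne; lra.
apply/trivIsetP => i j _ _ ij.
have [lij|lij|/val_inj eij] := ltngtP i j.
- exact: lt_dis.
- by rewrite setIC; exact: lt_dis.
- by rewrite eij eqxx in ij.
Qed.

Lemma variation_cons (R : realType) (a b x : R) (f : R -> R) (s : seq R) :
  variation a b f (x :: s) = `|f x - f a| + variation x b f s.
Proof. by rewrite /variation/= big_nat_recl. Qed.

Lemma variation_pairmap (R : realType) (a b : R) (f : R -> R) (s : seq R) :
  variation a b f s = \sum_(p <- pairmap pair a s) `|f p.2 - f p.1|.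
Proof.
elim: s a => [|x s IH] a; first by rewrite variation_nil big_nil.
by rewrite variation_cons IH /= big_cons.
Qed.

Lemma sum_pairmap_length (R : realType) (a : R) (s : seq R) :
  \sum_(p <- pairmap pair a s) (p.2 - p.1) = last a s - a.
Proof.
elim: s a => [|x s IH] a; first by rewrite big_nil subrr.
by rewrite /= big_cons IH /= addrC subrKA.
Qed.

Lemma nonoverlapping_pairmap (R : realType) (a : R) (s : seq R) :
  path <%R a s -> nonoverlapping a (last a s) (pairmap pair a s).
Proof.
elim: s a => [|x s IH] a //= /andP[ax /[dup] xs /IH].
rewrite /nonoverlapping /= => /andP[/allP ps pws].
have xl : x <= last x s by apply: (@itv_partition_le _ _ _ _ s); split.
rewrite lexx (ltW ax) xl pws /= andbT; apply/andP; split.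
  apply/allP => p /ps /and3P[xp -> ->].
  by rewrite (le_trans (ltW ax) xp).
by apply/allP => p /ps /and3P[->].
Qed.

Lemma nonoverlapping_refine (R : realType) (a b u w : R) (s : seq R)
    (B A : seq (R * R)) :
  itv_partition u w s -> nonoverlapping a b (B ++ (u, w) :: A) ->
  nonoverlapping a b ((B ++ pairmap pair u s) ++ A).
Proof.
case=> us /eqP lw; have := nonoverlapping_pairmap us; rewrite lw.
move=> /andP[/allP uws pws] /andP[].
rewrite all_cat/= => /and3P[aB /and3P[au uw wb] aA].
rewrite pairwise_cat allrel_consr/= => /and3P[/andP[Buw BA] pB /andP[uwA pA]].
rewrite /nonoverlapping -catA !all_cat !pairwise_cat aB aA pB pws pA !andbT/=.
rewrite allrel_catr BA/= andbT; apply/and3P; split.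
- apply/allP => p /uws/and3P[? -> ?].
  by rewrite (le_trans au)//= (le_trans _ wb).
- apply/allrelP => p q /(allP Buw)/= pq /uws/and3P[uq _ qw].
  by case/orP: pq => h; apply/orP; [left|right];
    apply: le_trans h _ || apply: le_trans _ h.
- apply/allrelP => p q /uws/and3P[up _ pw] /(allP uwA)/= pq.
  by case/orP: pq => h; apply/orP; [left|right];
    apply: le_trans h _ || apply: le_trans _ h.
Qed.

(** The modulus of absolute continuity of f also works for its variation.
    The intervals of A are refined one after the other by arbitrary
    partitions, whose pieces are moved to B; taking suprema turns the
    increments into variations. *)
Lemma ac_seq_total_variation (R : realType) (a b : R) (f : R -> R) (d e : R) :
  (forall s, nonoverlapping a b s -> \sum_(p <- s) (p.2 - p.1) < d ->
    \sum_(p <- s) `|f p.2 - f p.1| < e) ->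
  forall A B, nonoverlapping a b (B ++ A) ->
    \sum_(p <- B ++ A) (p.2 - p.1) < d ->
    ((\sum_(p <- B) `|f p.2 - f p.1|)%:E +
      \sum_(p <- A) total_variation p.1 p.2 f <= e%:E)%E.
Proof.
move=> H; elim=> [|[u w] A IH] B BA dBA.
  by rewrite big_nil adde0 lee_fin ltW// H// -[B]cats0.
have uw : u <= w.
  by case/andP: BA => + _; rewrite all_cat/= => /and3P[_ /and3P[]].
(* Replacing (u, w) by the pieces of a partition s keeps the total length. *)
have step s : itv_partition u w s ->
    ((\sum_(p <- B) `|f p.2 - f p.1|)%:E + ((variation u w f s)%:E +
      \sum_(p <- A) total_variation p.1 p.2 f) <= e%:E)%E.
  move=> uws; rewrite variation_pairmap addeA -EFinD -big_cat/=; apply: IH.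
    exact: nonoverlapping_refine uws BA.
  apply: le_lt_trans dBA; rewrite -catA !big_cat/= !big_cons/=.
  by rewrite sum_pairmap_length; case: uws => _ /eqP ->.
rewrite big_cons/=.
have tvA0 : (0 <= \sum_(p <- A) total_variation p.1 p.2 f)%E.
  rewrite big_seq; apply: sume_ge0 => p pA; apply: total_variation_ge0.
  case/andP: BA => + _; rewrite all_cat/= => /and3P[_ _ /allP/(_ _ pA)].
  by case/and3P.
have [s0 s0P] : exists s0, itv_partition u w s0.
  move: uw; rewrite le_eqVlt => /predU1P[->|uw]; first by exists [::].
  by exists [:: w]; exact: itv_partition1.
have finA : (\sum_(p <- A) total_variation p.1 p.2 f)%E \is a fin_num.
  rewrite ge0_fin_numE//; have := step _ s0P.
  by apply: contraTT; rewrite -leNgt leye_eq => /eqP ->; rewrite !addey.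
rewrite -(fineK finA) in step *.
rewrite [X in (_ + X)%E]addeC addeA -leeBrDl//.
apply: ge_ereal_sup => _ [_ [s us <-] <-].
by rewrite leeBrDl// -addeA (addeC _ (variation _ _ _ _)%:E); exact: step.
Qed.

Lemma ac_bounded_variation (R : realType) (a b : R) (f : R -> R) :
  absolutely_continuous a b (f : R -> R^o) -> a <= b -> bounded_variation a b f.
Proof.
move=> acf ab; apply/bounded_variationP => //.
have [d d0 /ac_seq_total_variation H] := ac_seq acf ltr01.
have short s t : a <= s -> s <= t -> t <= b -> t - s < d ->
    (total_variation s t f <= 1%:E)%E.
  move=> sa st tb std; have := H [:: (s, t)] [::].
  rewrite /nonoverlapping/= !big_nil !big_cons !big_nil/= sa st tb add0e adde0 addr0.
  exact.
(* Chop [a, b] into pieces of length d / 2, each of variation at most 1. *)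
suff long n t : a <= t <= b -> t - a <= n%:R * (d / 2) ->
    (total_variation a t f <= n%:R%:E)%E.
  have d20 : 0 < d / 2 by rewrite divr_gt0.
  rewrite ge0_fin_numE ?total_variation_ge0//.
  apply: (@le_lt_trans _ _ (Num.bound ((b - a) / (d / 2)))%:R%:E); last exact: ltry.
  apply: long; rewrite ?ab ?lexx// -ler_pdivrMr//.
  by rewrite ltW// archi_boundP// divr_ge0 ?subr_ge0// ltW.
elim: n t => [|n IH] t /andP[ta tb].
  rewrite mul0r subr_le0 => ta'.
  by rewrite (@le_anti _ _ t a) ?ta ?ta'// total_variationxx.
have [|] := leP (t - a) (n%:R * (d / 2)).
  by move=> /IH tn _; rewrite (le_trans (tn _)) ?ta// lee_fin ler_nat.
rewrite -[n.+1]addn1 natrD mulrDl mul1r => h1 h2.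
have [s2|s2] := leP a (t - d / 2); last first.
  apply: (le_trans (short _ _ _ _ _ _)) => //; first by lra.
  by rewrite lee_fin lerDr.
rewrite (total_variationD f s2); last by lra.
by rewrite EFinD leeD ?IH ?short//; lra.
Qed.

(** The variation over s <= t is V t - V s, so this is
    [ac_seq_total_variation] without the extra list. *)
Lemma ac_total_variation (R : realType) (a b : R) (f : R -> R) :
  absolutely_continuous a b (f : R -> R^o) -> a <= b ->
  absolutely_continuous a b (fun t => fine (total_variation a t f) : R^o).
Proof.
move=> acf ab e e0; have bv := ac_bounded_variation acf ab.
have fin s t : a <= s -> s <= t -> t <= b -> total_variation s t f \is a fin_num.
  move=> sa st tb; apply/bounded_variationP => //.
  apply: (bounded_variationl st tb).
  by apply: bounded_variationr bv => //; exact: le_trans st tb.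
have e20 : 0 < e / 2 by rewrite divr_gt0.
have [d d0 H] := ac_seq acf e20.
exists d => // n I Iab tI dI.
(* Degenerate intervals must go: an interior point of another interval is
   disjoint from it as an open interval, yet lies on neither side of it. *)
pose s := [seq p <- [seq I i | i <- enum 'I_n] | p.1 < p.2].
have sE (F : R * R -> R) : (forall p, p.1 = p.2 -> F p = 0) ->
    \sum_(i < n) F (I i) = \sum_(p <- s) F p.
  move=> F0; rewrite big_filter big_map [in RHS]big_mkcond/= big_enum/=.
  apply: eq_bigr => i _; case: ifPn => //; rewrite -leNgt => h.
  by apply: F0; apply/le_anti; rewrite h; case: (Iab i) => _ ->.
rewrite (sE (fun p => p.2 - p.1)) in dI; last by move=> p ->; rewrite subrr.
rewrite (sE (fun p => `|fine (total_variation a p.2 f) -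
  fine (total_variation a p.1 f)|)); last by move=> p ->; rewrite subrr normr0.
have sP : nonoverlapping a b s.
  apply/andP; split.
    apply/allP => p; rewrite mem_filter => /andP[_ /mapP[i _ ->]].
    by apply/and3P; exact: Iab.
  rewrite /s filter_map pairwise_map.
  apply: (@sub_in_pairwise _ (fun i => (I i).1 < (I i).2) (fun i j => i != j)).
  - move=> i j; rewrite !unfold_in => Ii Ij ij.
    have /trivIsetP/(_ i j Logic.I Logic.I ij) := tI.
    apply: contra_eqT; rewrite negb_or -!ltNge => /andP[h1 h2].
    apply/set0P.
    exists ((Num.max (I i).1 (I j).1 + Num.min (I i).2 (I j).2) / 2).
    have h : Num.max (I i).1 (I j).1 < Num.min (I i).2 (I j).2.
      by rewrite lt_min !gt_max Ii Ij h1 h2.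
    have [] := midf_lt h; rewrite gt_max lt_min => /andP[a1 a2] /andP[b1 b2].
    by split; rewrite /= in_itv/=; apply/andP.
  - exact/filter_all.
  - by rewrite -uniq_pairwise filter_uniq// enum_uniq.
have := ac_seq_total_variation H (A := s) (B := [::]) sP dI.
rewrite big_nil add0e => le_e2.
rewrite -lte_fin (@le_lt_trans _ _ (e / 2)%:E)//; last by rewrite lte_fin; lra.
apply: le_trans le_e2; rewrite -sumEFin big_seq [leRHS]big_seq.
apply: lee_sum => p ps; case/andP: sP => /allP/(_ _ ps)/and3P[ap pp pb] _.
have ab1 := fin a p.1 (lexx _) ap (le_trans pp pb).
have ab2 := fin a p.2 (lexx _) (le_trans ap pp) pb.
have ab3 := fin p.1 p.2 ap pp pb.
rewrite -fineB//.
rewrite (total_variationD f ap pp) addeAC subee// add0e.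
by rewrite ger0_norm ?fine_ge0 ?total_variation_ge0// fineK.
Qed.

Lemma total_variation_increment (R : realType) (a b s t : R) (f : R -> R) :
  bounded_variation a b f -> a <= s -> s <= t -> t <= b ->
  `|f t - f s| <= fine (total_variation a t f) - fine (total_variation a s f).
Proof.
move=> bv sa st tb; have at_ := le_trans sa st; have sb := le_trans st tb.
have fint : total_variation a t f \is a fin_num.
  by apply/bounded_variationP => //; exact: bounded_variationl bv.
have fins : total_variation a s f \is a fin_num.
  by apply/bounded_variationP => //; exact: bounded_variationl bv.
have finst : total_variation s t f \is a fin_num.
  apply/bounded_variationP => //; apply: (bounded_variationl st tb).
  exact: bounded_variationr bv.
rewrite -fineB// (total_variationD f sa st) addeAC subee// add0e.
by rewrite -lee_fin fineK//; exact: total_variation_ge.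
Qed.

Lemma ac_bounded (R : realType) (V : normedModType R) (a b : R) (f : R -> V) :
  absolutely_continuous a b f -> a <= b ->
  exists2 M : R, 0 <= M & forall t, a <= t -> t <= b -> `|f t| <= M.
Proof.
move=> acf ab; have acn := ac_norm acf.
have bv := ac_bounded_variation acn ab.
pose TV := fine (total_variation a b (fun t => `|f t|)).
have TV0 : 0 <= TV by rewrite fine_ge0// total_variation_ge0.
exists (`|f a| + TV) => [|t at_ tb]; first by rewrite addr_ge0.
have := total_variation_increment bv (lexx a) at_ tb.
have := total_variation_increment bv at_ tb (lexx b).
rewrite total_variationxx /= -/TV => h1 h2.
have := normr_ge0 (`|f b| - `|f t|); have := ler_norm (`|f t| - `|f a|); lra.
Qed.

Lemma ac_scale (R : realType) (V : normedModType R) (a b : R) (c : R -> R) (f : R -> V) :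
  a <= b -> absolutely_continuous a b (c : R -> R^o) -> absolutely_continuous a b f ->
  absolutely_continuous a b (fun t => c t *: f t).
Proof.
move=> ab acc acf; have [A A0 cA] := ac_bounded acc ab.
have [B B0 fB] := ac_bounded acf ab.
apply: (ac_dominated acc acf (addr_ge0 A0 B0)) => s t as_ st tb.
have -> : c t *: f t - c s *: f s = (c t - c s) *: f t + c s *: (f t - f s).
  by rewrite scalerBl scalerBr addrA subrK.
rewrite (le_trans (ler_normD _ _))// !normrZ.
have h1 : `|c t - c s| * `|f t| <= `|c t - c s| * B.
  by rewrite ler_wpM2l// fB// (le_trans as_).
have h2 : `|c s| * `|f t - f s| <= A * `|f t - f s|.
  by rewrite ler_wpM2r// cA// (le_trans st).
have := mulr_ge0 A0 (normr_ge0 (c t - c s)); have := mulr_ge0 B0 (normr_ge0 (f t - f s)).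
lra.
Qed.

(** * Densities *)

Lemma open_interval_finite_measure (R : realType) (J : set R) :
  open J -> is_interval J -> (lebesgue_measure J < +oo)%E ->
  exists p : R * R, p.1 <= p.2 /\ J = `]p.1, p.2[%classic.
Proof.
move=> oJ iJ Jfin; have [J0|/set0P[z Jz]] := eqVneq J set0.
  by exists (0, 0); split => //=; rewrite J0 set_itvoo0.
have JE := (is_intervalP J).1 iJ.
suff [p Jp] : exists p : R * R, J = `]p.1, p.2[%classic.
  exists p; split => //; move: Jz; rewrite Jp /= in_itv/= => /andP[h1 h2].
  by rewrite ltW// (lt_trans h1).
have JI := (interior_id J).1 oJ.
have JE' : J = [set` Rhull J] by exact: JE.
have mJ : lebesgue_measure [set` Rhull J] \is a fin_num.
  by rewrite -JE' ge0_fin_numE.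
have nJ : [set` Rhull J] z by rewrite -JE'.
move: JE' mJ nJ; case: (Rhull J) => [[x a|[]] [y b|[]]] JE';
  rewrite lebesgue_measure_itv/= ?in_itv//= ?ltry ?ltNyr//=.
  by exists (a, b); rewrite -JI JE' interior_itv_bnd.
by rewrite andbF.
Qed.

Lemma lebesgue_stieltjes_itvoc (R : realType) (G : cumulative R R) (s t : R) :
  s <= t -> lebesgue_stieltjes_measure G `]s, t]%classic = (G t - G s)%:E.
Proof.
move=> st; rewrite /lebesgue_stieltjes_measure /measure_extension.
by rewrite measurable_mu_extE/=; [rewrite wlength_itv_bnd|exact: is_ocitv].
Qed.

(** A Lebesgue null set is covered by open sets of small measure; the
    components of such a set are disjoint intervals of small total length,
    on which G increases little. *)
Lemma lebesgue_stieltjes_dominates (R : realType) (G : cumulative R R) :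
  (forall e, 0 < e -> exists2 d : R, 0 < d & forall n (p : 'I_n -> R * R),
    (forall i, (p i).1 <= (p i).2) ->
    trivIset setT (fun i => `](p i).1, (p i).2[%classic) ->
    \sum_(i < n) ((p i).2 - (p i).1) < d ->
    \sum_(i < n) (G (p i).2 - G (p i).1) < e) ->
  lebesgue_stieltjes_measure G `<< @lebesgue_measure R.
Proof.
move=> Gac; apply/null_content_dominatesP => A mA A0.
set nu := lebesgue_stieltjes_measure G.
apply/eqP; rewrite eq_le measure_ge0 andbT; apply/lee_addgt0Pr => e e0.
rewrite add0e; have [d d0 {}Gac] := Gac _ e0.
have [|U [oU AU Ud]] := lebesgue_regularity_outer mA _ d0; first by rewrite A0 ltry.
have mU : measurable U by exact: measurable_realfun.open_measurable.
have {}Ud : (lebesgue_measure U < d%:E)%E.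
  apply: le_lt_trans Ud; rewrite -[leRHS]add0e -A0 -measureU//.
  - by rewrite setDUK.
  - exact: measurableD.
  - by rewrite setDIK.
apply: (@le_trans _ _ (nu U)); first by rewrite le_measure ?inE.
(* Only finitely many components of U can be fed to the hypothesis at a time;
   the bound e passes to the limit of the partial sums. *)
pose J := open_disjoint_itv oU.
have mJ k : measurable (J k).
  by apply: measurable_realfun.open_measurable; exact: open_disjoint_itv_open.
have UE : U = \bigcup_k J k := open_disjoint_itv_bigcup oU.
have JU n : \big[setU/set0]_(k < n) J k `<=` U.
  apply: (@subset_trans _ (\bigcup_k J k)); first exact: bigsetU_bigcup.
  by rewrite -UE.
have tJ : trivIset setT J by exact: open_disjoint_itv_trivIset.
have Jd n : (\sum_(k < n) lebesgue_measure (J k) < d%:E)%E.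
  rewrite -(@measure_bigsetU _ _ _ (@lebesgue_measure R) J mJ tJ).
  apply: le_lt_trans Ud; rewrite le_measure ?inE//.
    by apply: bigsetU_measurable => i _; exact: mJ.
have /choice[p pJ] k : exists p : R * R, p.1 <= p.2 /\ J k = `]p.1, p.2[%classic.
  apply: open_interval_finite_measure.
  - exact: open_disjoint_itv_open.
  - exact: open_disjoint_itv_is_interval.
  - apply: le_lt_trans (ltry d); apply: ltW; apply: le_lt_trans (Jd k.+1).
    by rewrite big_ord_recr/= leeDr// sume_ge0.
have -> : nu U = lebesgue_stieltjes_measure G (\bigcup_k J k) by rewrite -UE.
rewrite (@measure_bigcup _ _ _ (lebesgue_stieltjes_measure G) setT J) //;
  last by move=> k _; exact: mJ.
under eq_eseriesl do rewrite in_setT.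
apply: lime_le; first exact: is_cvg_nneseries.
apply: nearW => n; rewrite big_mkord.
apply: (@le_trans _ _ (\sum_(k < n) (G (p k).2 - G (p k).1))%:E).
  rewrite -sumEFin; apply: lee_sum => k _; have [p12 Jk] := pJ k.
  rewrite -/(J k) Jk -lebesgue_stieltjes_itvoc// le_measure ?inE//.
  exact: subset_itv_oo_oc.
rewrite lee_fin ltW//; apply: (Gac n (fun k => p k)).
- by move=> k; have [] := pJ k.
- apply/trivIsetP => i j _ _ ij; rewrite -(pJ i).2 -(pJ j).2.
  by have /trivIsetP := tJ; exact.
- rewrite -lte_fin; apply: le_lt_trans (Jd n); rewrite -sumEFin.
  apply: lee_sum => k _; have [p12 ->] := pJ k.
  rewrite lebesgue_measure_itv/= lte_fin; case: ltP => // p21.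
  by rewrite lee_fin subr_le0.
Qed.

(** The density is the Radon-Nikodym derivative of the Lebesgue-Stieltjes
    measure of f. *)
Lemma ac_nondecreasing_density (R : realType) (a b : R) (f : R -> R) :
  absolutely_continuous a b (f : R -> R^o) -> a <= b ->
  {in `[a, b] &, {homo f : s t / s <= t}} ->
  exists h : R -> R, lebesgue_measure.-integrable setT (EFin \o h) /\
    forall s t, a <= s -> s <= t -> t <= b ->
      f t - f s = \int[lebesgue_measure]_(z in `]s, t]) h z.
Proof.
move=> acf ab ndf.
(* A cumulative function lives on the whole line: extend f by constants. *)
pose clip t := Num.max a (Num.min t b).
have clipP t : [\/ t < a /\ clip t = a, a <= t <= b /\ clip t = t | b < t /\ clip t = b].
  rewrite /clip; have [ta|at_] := ltP t a.
    by constructor 1; rewrite (min_idPl _) ?(max_idPl _)//; lra.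
  have [tb|bt] := leP t b; last by constructor 3; rewrite (max_idPr _).
  by constructor 2; rewrite (max_idPr _)// at_ tb.
have clip_itv t : a <= clip t <= b.
  by case: (clipP t) => -[? ->]; lra.
have clip_id t : a <= t -> t <= b -> clip t = t.
  by case: (clipP t) => -[? ->]; lra.
have clip_homo s t : s <= t -> clip s <= clip t.
  by case: (clipP s) => -[? ->]; case: (clipP t) => -[? ->]; lra.
have clip_lip s t : s <= t -> clip t - clip s <= t - s.
  by case: (clipP s) => -[? ->]; case: (clipP t) => -[? ->]; lra.
have clip_lt s z t : clip s < z -> z < clip t -> s < z < t.
  by case: (clipP s) => -[? ->]; case: (clipP t) => -[? ->]; lra.
pose G t := f (clip t).
have Gac e : 0 < e -> exists2 d : R, 0 < d & forall n (p : 'I_n -> R * R),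
    (forall i, (p i).1 <= (p i).2) ->
    trivIset setT (fun i => `](p i).1, (p i).2[%classic) ->
    \sum_(i < n) ((p i).2 - (p i).1) < d ->
    \sum_(i < n) (G (p i).2 - G (p i).1) < e.
  move=> e0; have [d d0 H] := acf _ e0; exists d => // n p p12 tp pd.
  have := H n (fun i => (clip (p i).1, clip (p i).2)).
  have -> : \sum_(i < n) (G (p i).2 - G (p i).1) =
      \sum_(i < n) `|f (clip (p i).2) - f (clip (p i).1)|.
    apply: eq_bigr => i _; rewrite ger0_norm// subr_ge0.
    by apply: ndf; rewrite ?in_itv//=; exact: clip_homo.
  apply => [i| |].
  - by rewrite /= clip_homo//; split=> //; have /andP[] := clip_itv (p i).1;
      have /andP[] := clip_itv (p i).2.
  - apply/trivIsetP => i j _ _ ij; rewrite -subset0 => z [] /=.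
    rewrite !in_itv/= => /andP[z1 z2] /andP[z3 z4].
    have /trivIsetP/(_ i j Logic.I Logic.I ij) := tp.
    rewrite -subset0 => /(_ z); apply; split; rewrite /= in_itv/=.
      exact: clip_lt z1 z2.
    exact: clip_lt z3 z4.
  - by apply: le_lt_trans pd; apply: ler_sum => i _; exact: clip_lip.
have Gnd : nondecreasing G.
  by move=> s t st; apply: ndf; rewrite ?in_itv//=; exact: clip_homo.
have Gcont : continuous G.
  move=> t; apply/cvgrPdist_lt => e e0; have [d d0 H] := Gac _ e0.
  have osc u w : u <= w -> w - u < d -> G w - G u < e.
    move=> uw uwd; have := H 1%N (fun=> (u, w)).
    rewrite !big_ord_recl !big_ord0 /= !addr0; apply => //.
    by apply/trivIsetP => i j _ _; rewrite !ord1 eqxx.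
  exists d => //= s; rewrite /ball/= => std; have [st|ts] := leP s t.
    by rewrite ger0_norm ?osc ?subr_ge0 ?Gnd// -(ger0_norm (_ : 0 <= t - s)) ?subr_ge0.
  rewrite distrC ger0_norm ?osc ?subr_ge0 ?Gnd// ?(ltW ts)//.
  by rewrite -(ger0_norm (_ : 0 <= s - t)) ?subr_ge0 ?(ltW ts)// distrC.
have Grc : right_continuous G by apply: right_continuousW.
pose Gc : cumulative R R := HB.pack G (isCumulative.Build R _ R G Gnd Grc).
(* Restricting to ]a, b] makes the measure finite. *)
pose D := `]a, b]%classic.
have nuD : (lebesgue_stieltjes_measure Gc D < +oo)%E.
  by rewrite /D lebesgue_stieltjes_itvoc// ltry.
have mD : measurable (D : set (measurableTypeR R)) by exact: measurable_itv.
pose nu : {finite_measure set (measurableTypeR R) -> \bar R} := mfrestr mD nuD.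
have numu : nu `<< @lebesgue_measure R.
  apply/null_content_dominatesP => A mA A0.
  have /null_content_dominatesP/(_ A mA A0) := lebesgue_stieltjes_dominates (G := Gc) Gac.
  move=> A0'; apply/eqP; rewrite eq_le measure_ge0 andbT -A0'.
  rewrite /nu /= /mfrestr /mrestr.
  by apply: (@le_measure _ _ _ (lebesgue_stieltjes_measure Gc)); rewrite ?inE//;
    exact: measurableI.
have [g [g0 gfin gint gE]] := radon_nikodym_sigma_finite numu.
pose h z := fine (g z).
have hE : EFin \o h = g by apply/funext => z; rewrite /= fineK.
exists h; rewrite hE; split => // s t as_ st tb; rewrite /Rintegral.
under eq_integral do rewrite /h fineK//.
rewrite -gE; last exact: (measurable_itv `]s, t]).
rewrite /nu /= /mfrestr /mrestr /D setIidl; last first.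
  by move=> z /=; rewrite !in_itv/= => /andP[h1 h2]; lra.
rewrite lebesgue_stieltjes_itvoc//= /G.
have st' := le_trans as_ st; have tb' := le_trans st tb.
by rewrite !clip_id.
Qed.

(** Jordan decomposition: f is the difference of V and V - f, where V is the
    variation function of f. *)
Lemma ac_density (R : realType) (a b : R) (f : R -> R) :
  absolutely_continuous a b (f : R -> R^o) -> a <= b ->
  exists h : R -> R, lebesgue_measure.-integrable setT (EFin \o h) /\
    forall s t, a <= s -> s <= t -> t <= b ->
      f t - f s = \int[lebesgue_measure]_(z in `]s, t]) h z.
Proof.
move=> acf ab; have bv := ac_bounded_variation acf ab.
pose V t := fine (total_variation a t f).
have acV : absolutely_continuous a b (V : R -> R^o) by exact: ac_total_variation.
have VD s t : a <= s -> s <= t -> t <= b -> `|f t - f s| <= V t - V s.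
  exact: total_variation_increment bv.
have [|h1 [ih1 h1E]] := ac_nondecreasing_density acV ab.
  move=> s t; rewrite !in_itv/= => /andP[? ?] /andP[? ?] st.
  by rewrite -subr_ge0 (le_trans _ (VD _ _ _ _ _)).
have [|h2 [ih2 h2E]] := ac_nondecreasing_density (acB acV acf) ab.
  move=> s t; rewrite !in_itv/= => /andP[? ?] /andP[? ?] st.
  have {}VD : `|f t - f s| <= V t - V s by exact: VD.
  by have := le_trans (ler_norm _) VD; lra.
exists (h1 \- h2); split.
  have -> : EFin \o (h1 \- h2) = ((EFin \o h1) \- (EFin \o h2))%E by [].
  exact: integrableB.
have sub (g : R -> \bar R) (s t : R) : lebesgue_measure.-integrable setT g ->
    lebesgue_measure.-integrable `]s, t] g.
  by apply: integrableS => //; exact: measurable_itv.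
move=> s t sa st tb; rewrite RintegralB//; [|exact: sub..].
by rewrite -h1E// -h2E//; lra.
Qed.

Lemma ac_integrable (R : realType) (a b : R) (f : R -> R) :
  absolutely_continuous a b (f : R -> R^o) -> a <= b ->
  lebesgue_measure.-integrable `[a, b] (EFin \o f).
Proof.
move=> acf ab; apply: continuous_compact_integrable; first exact: segment_compact.
apply/subspace_continuousP => t; rewrite /= in_itv/= => /andP[at_ tb].
apply/cvgrPdist_lt => e /(ac_seq acf)[d d0 H].
have osc s u : a <= s -> s <= u -> u <= b -> u - s < d -> `|f u - f s| < e.
  move=> as_ su ub sud; have := H [:: (s, u)].
  rewrite /nonoverlapping /= as_ su ub !big_cons !big_nil/= !addr0.
  exact.
exists d => //= s; rewrite /ball/= in_itv/= => std /andP[as_ sb].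
have [st|ts] := leP s t.
  by apply: osc => //; rewrite -(ger0_norm (_ : 0 <= t - s)) ?subr_ge0.
rewrite distrC; apply: osc => //; first exact: ltW.
by rewrite -(ger0_norm (_ : 0 <= s - t)) ?subr_ge0 ?(ltW ts)// distrC.
Qed.

(** * Integration of almost everywhere inequalities *)

Section integral_comparison.
Context d (T : measurableType d) (R : realType) (mu : {measure set T -> \bar R}).
Local Open Scope ereal_scope.

(** The integral of a nonnegative function is a supremum over the simple
    functions below it, which is monotone for arbitrary functions. This
    matters because the derivative of an absolutely continuous function is
    only compared with a measurable density, up to a null set. *)
Lemma ge0_le_integralT_nonmeasurable (f g : T -> \bar R) :
  (forall x, 0 <= f x) -> (forall x, f x <= g x) ->
  \int[mu]_x f x <= \int[mu]_x g x.
Proof.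
move=> f0 fg; have g0 x : 0 <= g x by exact: le_trans (fg x).
rewrite !ge0_integralTE//; apply: ge_ereal_sup => _ [h hf <-].
by apply: ereal_sup_ubound; exists h => // x; exact: le_trans (fg x).
Qed.

Lemma ae_ge0_le_integral_nonmeasurable (D : set T) (f g : T -> \bar R) :
  measurable D -> measurable_fun D f ->
  (forall x, 0 <= f x) -> (forall x, 0 <= g x) ->
  {ae mu, forall x, D x -> f x <= g x} ->
  \int[mu]_(x in D) f x <= \int[mu]_(x in D) g x.
Proof.
move=> mD mf f0 g0 [N [mN N0 DN]].
(* Remove the exceptional null set from the integral of the measurable f; the
   integral of g only has to decrease. *)
have -> : \int[mu]_(x in D) f x = \int[mu]_(x in D `\` N) f x.
  rewrite setDE integral_mkcondr; apply: ge0_ae_eq_integral => //.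
  - apply: (measurable_restrict f (measurableC mN) mD).1.
    exact: measurable_funS mf.
  - by move=> x _; rewrite patchE; case: ifP.
  - exists N; split => // x /= /not_implyP[Dx fx]; apply: contrapT => Nx.
    by apply: fx; rewrite patchE mem_set.
rewrite !(integral_mkcond _ f) (integral_mkcond _ g).
apply: ge0_le_integralT_nonmeasurable => x.
  by rewrite patchE; case: ifP.
rewrite !patchE; case: ifPn => [|_]; last by case: ifP.
rewrite inE => -[Dx Nx]; rewrite mem_set//.
by apply: contrapT => fg; apply/Nx/DN => /= /(_ Dx).
Qed.

Lemma ae_le_Rintegral (D : set T) (f g : T -> R) : measurable D ->
  mu.-integrable D (EFin \o f) -> mu.-integrable D (EFin \o g) ->
  {ae mu, forall x, D x -> (f x <= g x)%R} ->
  (\int[mu]_(x in D) f x <= \int[mu]_(x in D) g x)%R.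
Proof.
move=> mD intf intg fg; rewrite -subr_ge0 -RintegralB//.
have intB : mu.-integrable D (EFin \o (fun x => g x - f x)%R).
  by rewrite (_ : _ \o _ = (EFin \o g) \- (EFin \o f))//; exact: integrableB.
rewrite /Rintegral (ae_eq_integral (fun x => (Num.max (g x - f x) 0)%:E))//.
- by rewrite fine_ge0// integral_ge0// => x _; rewrite lee_fin le_max lexx orbT.
- exact: measurable_int intB.
- apply/measurable_EFinP; apply: measurable_maxr => //.
  by apply/measurable_EFinP; exact: measurable_int intB.
- move: fg; apply: filterS => x fg Dx; congr (_%:E); apply/esym/max_idPl.
  by rewrite subr_ge0 fg.
Qed.

End integral_comparison.

#[global] Instance ae_lebesgue_filter (R : realType) :
  Filter (nbhs (almost_everywhere (@lebesgue_measure R))).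
Proof. exact: (ae_filter_ringOfSetsType (@lebesgue_measure R)). Qed.

Lemma ae_neq (R : realType) (c : R) : {ae lebesgue_measure, forall t : R, t != c}.
Proof.
exists [set c]; split => [||t /= /negP]; first exact: measurable_set1.
  exact: lebesgue_measure_set1.
by rewrite negbK => /eqP.
Qed.

(** Lebesgue's differentiation theorem, transported from the indefinite
    integral of h to f. *)
Lemma density_derivable (R : realType) (a b : R) (f h : R -> R) :
  lebesgue_measure.-integrable setT (EFin \o h) ->
  (forall s t, a <= s -> s <= t -> t <= b ->
      f t - f s = \int[lebesgue_measure]_(z in `]s, t]) h z) ->
  {ae lebesgue_measure, forall t, a < t < b ->
    derivable (f : R -> R^o) t 1 /\ f^`()%classic t = h t}.
Proof.
move=> inth fE; have inth' (i : interval R) :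
    lebesgue_measure.-integrable [set` i] (EFin \o h).
  by apply: integrableS inth => //; exact: measurable_itv.
(* Near t, f differs by a constant from the indefinite integral F of h. *)
pose F x := \int[lebesgue_measure]_(t in `]-oo, x]) h t.
have loch : locally_integrable setT h.
  by apply: open_integrable_locally => //; exact: openT.
have := FTC1Ny (fun y => inth' `]-oo, y]) loch.
apply: filterS => t [dF F'] /andP[at_ tb].
have FD s u : s <= u -> F u - F s = \int[lebesgue_measure]_(z in `]s, u]) h z.
  by move=> su; apply: Rintegral_itvB; rewrite ?bnd_simp.
have : is_derive t 1 (f : R -> R^o) (h t).
  apply: (@near_eq_is_derive _ R^o R^o (F + cst (f a - F a))).
    near=> z.
    have az : a <= z by apply: ltW; near: z; exact: lt_nbhsr.
    have zb : z <= b by apply: ltW; near: z; exact: lt_nbhsl.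
    rewrite /= -[RHS](subrK (f a)) [in RHS]fE// -FD//.
    by rewrite fctE /cst addrA addrAC.
  rewrite -[h t]addr0; apply: is_deriveD.
  by apply: DeriveDef; [exact: dF|rewrite -derive1E; exact: F'].
by case=> df fh; split => //; rewrite derive1E.
Unshelve. all: by end_near. Qed.

Lemma ac_derivable (R : realType) (a b : R) (f : R -> R) : a <= b ->
  absolutely_continuous a b (f : R -> R^o) ->
  {ae lebesgue_measure, forall t, a < t < b -> derivable (f : R -> R^o) t 1}.
Proof.
move=> ab acf; have [h [inth fE]] := ac_density acf ab.
by apply: filterS (density_derivable inth fE) => t H /H[].
Qed.

(** A differential inequality may be integrated even though f' is only
    defined almost everywhere: f' agrees with a density. *)
Lemma ac_increment_le (R : realType) (a b : R) (f g : R -> R) : a <= b ->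
  absolutely_continuous a b (f : R -> R^o) ->
  lebesgue_measure.-integrable `]a, b] (EFin \o g) ->
  {ae lebesgue_measure, forall t, a < t < b -> derivable (f : R -> R^o) t 1 ->
    f^`()%classic t <= g t} ->
  f b - f a <= \int[lebesgue_measure]_(z in `]a, b]) g z.
Proof.
move=> ab acf intg f'g; have [h [inth fE]] := ac_density acf ab.
rewrite fE//; apply: ae_le_Rintegral => //.
  by apply: integrableS inth => //; exact: measurable_itv.
apply: filterS3 (density_derivable inth fE) f'g (ae_neq b) => t H1 H2 tb.
rewrite /= in_itv/= le_eqVlt (negbTE tb)/= => /[dup] /H1[df <-] /H2; exact.
Qed.

Lemma ac_nonincreasing (R : realType) (a b t : R) (f : R -> R) :
  absolutely_continuous a b (f : R -> R^o) -> a <= t -> t <= b ->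
  {ae lebesgue_measure, forall t, a < t < b -> derivable (f : R -> R^o) t 1 ->
    f^`()%classic t <= 0} ->
  f t <= f a.
Proof.
move=> acf at_ tb f'0; rewrite -subr_le0.
have -> : 0 = \int[lebesgue_measure]_(z in `]a, t]) 0 :> R.
  by rewrite /Rintegral integral0.
apply: ac_increment_le => //; first exact: ac_subitv acf.
  exact: integrable0.
by apply: filterS f'0 => s H /andP[as_ st]; apply: H; rewrite as_ (lt_le_trans st).
Qed.

Lemma variation_le_increment (R : realType) (a b : R) (f W : R -> R) (s : seq R) :
  (forall s t, a <= s -> s <= t -> t <= b -> `|f t - f s| <= W t - W s) ->
  itv_partition a b s -> variation a b f s <= W b - W a.
Proof.
elim: s a => [|x s IH] a H.
  by move=> /itv_partition_nil ->; rewrite variation_nil subrr.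
move=> axs; have xs := itv_partition_cons axs; have xb := itv_partition_le xs.
have ax : a <= x by case: axs => /= /andP[/ltW].
have h1 : `|f x - f a| <= W x - W a by exact: H.
have h2 : variation x b f s <= W b - W x.
  by apply: IH => // u w xu; apply: H; exact: le_trans ax xu.
by rewrite variation_cons; lra.
Qed.

(** Each increment of f is at most the integral of |h| for a density h, and
    these integrals add up along a partition. The function g stands for f'
    and need not be measurable. *)
Lemma ac_total_variation_le (R : realType) (a b : R) (f g : R -> R) : a <= b ->
  absolutely_continuous a b (f : R -> R^o) ->
  {ae lebesgue_measure, forall t, a < t < b -> f^`()%classic t = g t} ->
  (total_variation a b f <= \int[lebesgue_measure]_(z in `[a, b]) `|g z|%:E)%E.
Proof.
move=> ab acf f'g; have [h [inth fE]] := ac_density acf ab.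
have inth' (i : interval R) :
    lebesgue_measure.-integrable [set` i] (EFin \o (fun z => `|h z|)).
  have := integrable_abse inth; apply: integrableS => //; exact: measurable_itv.
pose W x := \int[lebesgue_measure]_(t in `]-oo, x]) `|h t|.
have WE s t : s <= t ->
    W t - W s = \int[lebesgue_measure]_(z in `]s, t]) `|h z|.
  by move=> su; apply: Rintegral_itvB; rewrite ?bnd_simp.
apply: (@le_trans _ _ (W b - W a)%:E).
  apply: ge_ereal_sup => _ [_ [s abs <-] <-]; rewrite lee_fin.
  apply: variation_le_increment => // u w au uw wb; rewrite fE// WE//.
  apply: le_normr_Rintegral => //.
  by apply: integrableS inth => //; exact: measurable_itv.
rewrite WE// /Rintegral fineK; last exact: integrable_fin_num (inth' _).
apply: (@le_trans _ _ (\int[lebesgue_measure]_(z in `[a, b]) `|h z|%:E)%E).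
  apply: ge0_subset_integral => //; first exact: measurable_int (inth' `[a, b]).
  exact: subset_itv_oc_cc.
apply: ae_ge0_le_integral_nonmeasurable => //.
- exact: measurable_int (inth' `[a, b]).
- have f'gh : {ae lebesgue_measure, forall t, a < t < b -> h t = g t}.
    by apply: filterS2 (density_derivable inth fE) f'g => t H1 H2 /[dup] /H1[_ <-] /H2.
  apply: filterS3 (ae_neq a) (ae_neq b) f'gh => t ta tb H.
  rewrite /= in_itv/= => /andP[at_ tb'].
  by rewrite H// !lt_neqAle eq_sym ta at_ tb tb'.
Qed.

(** * Right difference quotients *)

Lemma derivable_right_quotient (R : realType) (V : normedModType R) (f : R -> V)
    (t : R) : derivable f t 1 ->
  h^-1 *: (f (h + t) - f t) @[h --> 0^'+] --> f^`()%classic t.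
Proof.
move=> df; have : h^-1 *: (f (h *: 1 + t) - f t) @[h --> 0^'] --> f^`()%classic t.
  by rewrite derive1E.
rewrite (_ : (fun h => _) = (fun h : R => h^-1 *: (f (h + t) - f t))); last first.
  by apply/funext => h; rewrite [h *: 1]mulr1.
by apply: cvg_trans; apply: cvg_fmap2; apply: within_subset => /= h h0; rewrite gt_eqF.
Qed.

Lemma derivable_right_cvg (R : realType) (V : normedModType R) (f : R -> V) (t : R) :
  derivable f t 1 -> f (h + t) @[h --> 0^'+] --> f t.
Proof.
move=> /derivable1_diffP/differentiable_continuous fc.
have sh : (h + t) @[h --> 0^'+] --> t.
  apply: cvg_within_filter; rewrite -[in X in _ --> X](add0r t).
  by apply: cvgD; [exact: cvg_id|exact: cvg_cst].
exact: (cvg_comp _ _ sh fc).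
Qed.

(** Bounding the right difference quotients replaces the chain rule for
    functions, such as norms and energies along a trajectory, that are
    merely known to be differentiable at t. *)
Lemma derive_right_le (R : realType) (f : R -> R) (g : R -> R) (t l : R) :
  derivable (f : R -> R^o) t 1 -> g h @[h --> 0^'+] --> l ->
  (\forall h \near 0^'+, h^-1 * (f (h + t) - f t) <= g h) ->
  f^`()%classic t <= l.
Proof.
move=> /derivable_right_quotient df gl fg.
exact: (ler_cvg_to df gl).
Qed.

Lemma is_derive_derive1 (R : realType) (V : normedModType R) (f : R -> V) (t : R) :
  derivable f t 1 -> is_derive t 1 f (f^`()%classic t).
Proof. by move=> df; apply: DeriveDef; [exact: df|rewrite derive1E]. Qed.

Lemma derive1_norm_le_total_variation (R : realType) (a b t : R) (f : R -> R) :
  bounded_variation a b f -> a < t -> t < b ->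
  let V := fun s => fine (total_variation a s f) in
  derivable (f : R -> R^o) t 1 -> derivable (V : R -> R^o) t 1 ->
  `|f^`()%classic t| <= V^`()%classic t.
Proof.
move=> bv at_ tb V /derivable_right_quotient df /derivable_right_quotient dV.
apply: (ler_cvg_to (cvg_norm df) dV); near=> h.
have h0 : 0 < h by near: h; exact: nbhs_right_gt.
have hb : h + t <= b.
  by rewrite -lerBrDr; near: h; apply: nbhs_right_le; rewrite subr_gt0.
rewrite normrZ gtr0_norm ?invr_gt0// [leRHS]/GRing.scale/= ler_pM2l ?invr_gt0//.
by apply: (total_variation_increment bv); rewrite ?(ltW at_)// lerDr ltW.
Unshelve. all: by end_near. Qed.

(** * Gronwall's lemma *)

Lemma expRN_lip (R : realType) (p q : R) : 0 <= p -> p <= q ->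
  0 <= expR (- p) - expR (- q) <= q - p.
Proof.
move=> p0 pq; rewrite subr_ge0 ler_expR lerN2 pq/=.
have := expR_ge1Dx (p - q); have -> : expR (- q) = expR (- p) * expR (p - q).
  by rewrite -expRD; congr expR; lra.
have : expR (- p) <= 1 by rewrite expR_le1 oppr_le0.
have := expR_gt0 (- p); have := expR_gt0 (p - q); nra.
Qed.

(** Gronwall's lemma with an integrable coefficient K'. Stating it with the
    primitive K, rather than with its derivative, lets the variation
    function of lambda + eta play that role. *)
Lemma ac_gronwall (R : realType) (T : R) (u K g : R -> R) : 0 <= T ->
  absolutely_continuous 0 T (u : R -> R^o) ->
  absolutely_continuous 0 T (K : R -> R^o) ->
  (forall t, 0 <= t -> t <= T -> 0 <= u t) -> K 0 = 0 ->
  (forall s t, 0 <= s -> s <= t -> t <= T -> K s <= K t) ->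
  (forall t, 0 <= g t) -> lebesgue_measure.-integrable `]0, T] (EFin \o g) ->
  {ae lebesgue_measure, forall t, 0 < t < T ->
    derivable (u : R -> R^o) t 1 -> derivable (K : R -> R^o) t 1 ->
    u^`()%classic t <= K^`()%classic t * u t + g t} ->
  forall t, 0 <= t -> t <= T ->
    u t <= (u 0 + \int[lebesgue_measure]_(z in `]0, T]) g z) * expR (K T).
Proof.
move=> T0 acu acK u0 K0 Knd g0 intg ineq t t0 tT.
have Kge0 s : 0 <= s -> s <= T -> 0 <= K s by move=> s0 sT; rewrite -K0 Knd.
(* The integrating factor: U' = (u' - K' u) exp(- K) <= g almost everywhere. *)
pose U s := u s * expR (- K s).
have acU : absolutely_continuous 0 T (U : R -> R^o).
  have [B B0 uB] := ac_bounded acu T0.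
  have B10 : 0 <= 1 + B by rewrite addr_ge0.
  apply: (ac_dominated acu acK B10) => r s r0 rs sT.
  have s0 := le_trans r0 rs; have rT := le_trans rs sT.
  have /andP[e1 e2] := expRN_lip (Kge0 _ r0 rT) (Knd _ _ r0 rs sT).
  have Eu : `|expR (- K s)| <= 1.
    by rewrite ger0_norm ?expR_ge0// expR_le1 oppr_le0 Kge0.
  have -> : U s - U r = (u s - u r) * expR (- K s) - u r * (expR (- K r) - expR (- K s)).
    by rewrite /U; ring.
  rewrite (le_trans (ler_normB _ _))// !normrM (ger0_norm e1).
  have h1 : `|u s - u r| * `|expR (- K s)| <= `|u s - u r| by rewrite ler_piMr.
  have h2 : `|u r| * (expR (- K r) - expR (- K s)) <= B * `|K s - K r|.
    by rewrite ler_pM// ?uB// (le_trans e2)// ler_norm.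
  have := normr_ge0 (K s - K r); have := mulr_ge0 B0 (normr_ge0 (u s - u r)); lra.
have sub : `]0, t] `<=` `]0, T].
  by move=> z /=; rewrite !in_itv/= => /andP[-> /le_trans]; exact.
have intgt : lebesgue_measure.-integrable `]0, t] (EFin \o g).
  by apply: integrableS intg => //; exact: measurable_itv.
have Ut : U t - U 0 <= \int[lebesgue_measure]_(z in `]0, t]) g z.
  apply: ac_increment_le => //; first exact: ac_subitv acU.
  have dK := ac_derivable T0 acK; have du := ac_derivable T0 acu.
  apply: filterS3 ineq dK du => s H1 H2 H3 /andP[s0 st] _.
  have sT : 0 < s < T by rewrite s0 (lt_le_trans st).
  have {}H2 := H2 sT; have {}H3 := H3 sT; have {}H1 := H1 sT H3 H2.
  have iu : is_derive s 1 (u : R -> R^o) (u^`()%classic s).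
    exact: is_derive_derive1.
  have iK : is_derive s 1 (K : R -> R^o) (K^`()%classic s).
    exact: is_derive_derive1.
  have iE : is_derive s 1 (expR \o (- K)) (expR (- K s) * - K^`()%classic s).
    by apply: is_derive1_comp.
  have iU := is_deriveM iu iE.
  rewrite derive1E (_ : U = u * (expR \o (- K))) // (derive_val (is_derive := iU)).
  have E0 := expR_gt0 (- K s).
  have E1 : expR (- K s) <= 1.
    by rewrite expR_le1 oppr_le0 Kge0 ?(ltW s0)// (le_trans (ltW st)).
  rewrite /GRing.scale/=.
  have : expR (- K s) * u^`()%classic s <= expR (- K s) * (K^`()%classic s * u s + g s).
    by rewrite ler_pM2l.
  have : expR (- K s) * g s <= g s by rewrite ler_piMl.
  lra.
have intle : \int[lebesgue_measure]_(z in `]0, t]) g z <=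
    \int[lebesgue_measure]_(z in `]0, T]) g z.
  apply: fine_le.
  - by apply: integrable_fin_num => //; exact: measurable_itv.
  - by apply: integrable_fin_num => //; exact: measurable_itv.
  - apply: ge0_subset_integral => //; [exact: measurable_int intg|].
    by move=> z _; rewrite lee_fin.
have U0 : U 0 = u 0 by rewrite /U K0 oppr0 expR0 mulr1.
have -> : u t = U t * expR (K t) by rewrite /U -mulrA -expRD addNr expR0 mulr1.
have Ut0 : 0 <= U t by rewrite mulr_ge0 ?u0 ?expR_ge0.
apply: ler_pM => //.
  by rewrite -lerBlDl -U0; exact: le_trans Ut intle.
by rewrite ler_expR Knd.
Qed.

(** * Scalar product *)

Section dot_product.
Context (R : realType) (H : completeNormedModType R) (dot : {dot H for idfun}).
Context (hdot : induces_norm dot).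
Implicit Types u v w : H.

Lemma dotC u v : dot u v = dot v u.
Proof. by rewrite hermC expr0 mul1r. Qed.

Lemma dot_norm u : dot u u = `|u| ^+ 2.
Proof.
rewrite hdot sqr_sqrtr//; have [->|u0] := eqVneq u 0; first by rewrite linear0l.
exact/ltW/neq0_dnorm_gt0.
Qed.

Lemma dotDl u v w : dot (u + v) w = dot u w + dot v w.
Proof. exact: linearDl. Qed.

Lemma dotDr u v w : dot w (u + v) = dot w u + dot w v.
Proof. exact: linearDr. Qed.

Lemma dotNl u w : dot (- u) w = - dot u w.
Proof. exact: linearNl. Qed.

Lemma dotNr u w : dot w (- u) = - dot w u.
Proof. exact: linearNr. Qed.

Lemma dotZr (c : R) u w : dot w (c *: u) = c * dot w u.
Proof. exact: linearZr. Qed.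

Lemma dotZl (c : R) u w : dot (c *: u) w = c * dot u w.
Proof. by rewrite dotC dotZr dotC. Qed.

(** Testing against every h turns a vector identity into a polynomial
    identity between reals. *)
Lemma dot_ext u v : (forall h, dot u h = dot v h) -> u = v.
Proof.
move=> uv; apply/eqP; rewrite -subr_eq0 -normr_eq0 -sqrf_eq0 -dot_norm.
by rewrite dotDl dotNl uv subrr.
Qed.

Lemma normD_sqr u v : `|u + v| ^+ 2 = `|u| ^+ 2 + 2 * dot u v + `|v| ^+ 2.
Proof. by rewrite -!dot_norm dotDl !dotDr (dotC v u); lra. Qed.

(** Cauchy-Schwarz, by expanding the square of the triangle inequality. *)
Lemma dot_le_norm u v : dot u v <= `|u| * `|v|.
Proof.
have : `|u + v| ^+ 2 <= (`|u| + `|v|) ^+ 2.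
  by rewrite lerXn2r ?nnegrE ?addr_ge0// ler_normD.
by rewrite normD_sqr sqrrD -mulr_natl; lra.
Qed.

(** By polarization, from the continuity of the norm. *)
Lemma cvg_dot (T : Type) (F : set_system T) (FF : Filter F) (f g : T -> H) u v :
  f x @[x --> F] --> u -> g x @[x --> F] --> v ->
  dot (f x) (g x) @[x --> F] --> dot u v.
Proof.
move=> fu gv.
have polar a b : dot a b = 2^-1 * (`|a + b| ^+ 2 - `|a| ^+ 2 - `|b| ^+ 2).
  by rewrite normD_sqr; lra.
rewrite polar; under eq_fun do rewrite polar.
have sq (k : T -> H) w : k x @[x --> F] --> w ->
    `|k x| ^+ 2 @[x --> F] --> `|w| ^+ 2.
  move=> kw; apply: cvgM; exact: cvg_norm.
apply: cvgM; first exact: cvg_cst.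
by apply: cvgB; [apply: cvgB|]; apply: sq => //; exact: cvgD.
Qed.

End dot_product.

Lemma lipschitz_norm (R : realType) (H : normedModType R) (L : R) (f : H -> H) u v :
  L.-lipschitz f -> `|f u - f v| <= L * `|u - v|.
Proof. by move=> lip; apply: (lip (u, v)). Qed.

Lemma lipschitz_cvg (R : realType) (H : normedModType R) (L : R) (f : H -> H)
    (T : Type) (F : set_system T) (FF : Filter F) (g : T -> H) u :
  L.-lipschitz f -> g z @[z --> F] --> u -> f (g z) @[z --> F] --> f u.
Proof.
move=> lip /cvgrPdist_lt gu; apply/cvgrPdist_lt => e e0.
have L1 : 0 < `|L| + 1 by rewrite ltr_wpDl.
apply: filterS (gu _ (divr_gt0 e0 L1)) => z.
rewrite ltr_pdivlMr//; apply: le_lt_trans.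
rewrite (le_trans (lipschitz_norm _ _ lip))// mulrC ler_wpM2l//.
by rewrite (le_trans (ler_norm _))// lerDl.
Qed.

(** * Convex energies *)

Section convex.
Context (R : realType) (H : completeNormedModType R) (dot : {dot H for idfun}).
Context (phi : H -> \bar R) (psi : H -> R) (dpsi : H -> H).
Context (hdot : induces_norm dot) (phi_proper : proper_fun phi).
Context (psi_convex : convex_function [set: convex_lmodType H] psi).
Context (psi_grad : is_gradient dot psi dpsi).
Context (bounded : bounded_below (esum_fun phi psi)).

Lemma gradient_subgradient x y : psi x + dot (dpsi x) (y - x) <= psi y.
Proof.
have [dx dxE] := psi_grad x.
(* The slope of psi from x towards y is at most psi y - psi x at every step
   h <= 1; let h tend to 0. *)
rewrite -lerBrDl -dxE -(deriveE _ dx).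
have : h^-1 *: (psi (h *: (y - x) + x) - psi x) @[h --> 0^'+] --> 'D_(y - x) psi x.
  have := diff_derivable (v := y - x) dx.
  apply: cvg_trans; apply: cvg_fmap2.
  by apply: within_subset => /= h h0; rewrite gt_eqF.
move=> /ler_cvg_to; apply; first exact: cvg_cst.
near=> h.
have h0 : 0 < h by near: h; exact: nbhs_right_gt.
have h1 : h <= 1 by near: h; exact: nbhs_right_le.
rewrite /= [_ *: _]mulrC ler_pdivrMr//.
have : psi (h *: y + (1 - h) *: x) <= h * psi y + (1 - h) * psi x.
  by apply: (psi_convex (Itv01 (ltW h0) h1) (x := y) (y := x)); rewrite inE.
have -> : h *: y + (1 - h) *: x = h *: (y - x) + x.
  by rewrite scalerBr scalerBl scale1r addrA addrAC.
by lra.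
Unshelve. all: by end_near. Qed.

(** Meaningful where phi is finite, in particular at points that have a
    subgradient. *)
Definition energy z := fine (phi z) + psi z.

Lemma subdiff_fin_num x v : subdiff dot phi x v -> phi x \is a fin_num.
Proof.
have [phiNy [y phiy]] := phi_proper.
move=> /(_ y) xv; rewrite fin_numE phiNy/=; apply: contraTneq xv => ->.
by rewrite addye// leye_eq -ltey.
Qed.

Lemma energy_subgradient x y v w : subdiff dot phi x v -> subdiff dot phi y w ->
  energy x + dot (v + dpsi x) (y - x) <= energy y.
Proof.
move=> xv yw; have := xv y.
rewrite -(fineK (subdiff_fin_num xv)) -(fineK (subdiff_fin_num yw)).
rewrite -EFinD lee_fin => h1; have := gradient_subgradient x y.
by rewrite dotDl /energy; lra.
Qed.

Lemma energy_gap_ge x y v w : subdiff dot phi x v -> subdiff dot phi y w ->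
  energy x - energy y <= energy_gap (esum_fun phi psi) x.
Proof.
move=> xv yw; have eE z u : subdiff dot phi z u -> esum_fun phi psi z = (energy z)%:E.
  by move=> zu; rewrite /esum_fun -(fineK (subdiff_fin_num zu)).
rewrite /energy_gap (eE _ _ xv).
have [m mP] := bounded; set I := ereal_inf _.
have Iy : (I <= (energy y)%:E)%E by apply: ereal_inf_lbound; exists y => //; exact: eE yw.
have mI : (m%:E <= I)%E by apply: le_ereal_inf_tmp => _ [z _ <-].
have Ifin : I \is a fin_num.
  rewrite fin_numE -ltNye -ltey (lt_le_trans (ltNyr m) mI)/=.
  exact: le_lt_trans Iy (ltry _).
by move: Iy; rewrite -(fineK Ifin) lee_fin -EFinB /=; lra.
Qed.

Lemma subdiff_monotone x y v w : subdiff dot phi x v -> subdiff dot phi y w ->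
  0 <= dot (x - y) (v - w).
Proof.
move=> xv yw; have := xv y; have := yw x.
rewrite -(fineK (subdiff_fin_num xv)) -(fineK (subdiff_fin_num yw)).
have -> : dot (x - y) (v - w) = dot v (x - y) - dot w (x - y).
  by rewrite dotC dotDl dotNl.
by rewrite -!EFinD !lee_fin -[y - x]opprB dotNr; lra.
Qed.

End convex.

(** * A priori estimates *)

(** The optimised form of Young's inequality. *)
Lemma le_sqrt_young (R : realType) (A B r : R) : 0 < A -> 0 <= B ->
  (forall s, 0 < s -> r <= A / (2 * s) + B * s / 2) -> r <= Num.sqrt (A * B).
Proof.
move=> A0 B0 H; have [r0|r0] := leP r 0; first by rewrite (le_trans r0)// sqrtr_ge0.
(* The choice s = A / r, made for r itself and not for the minimiser, avoids
   the degenerate case B = 0. *)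
have Ar : 0 < A / r by rewrite divr_gt0.
have := H _ Ar; have -> : A / (2 * (A / r)) = r / 2 by field; rewrite !gt_eqF.
have -> : B * (A / r) / 2 = A * B / r / 2 by ring.
move=> h; have {h} : r <= A * B / r by lra.
rewrite ler_pdivlMr// -expr2 => h.
by rewrite -(ger0_norm (ltW r0)) -sqrtr_sqr ler_sqrt// mulr_ge0// ltW.
Qed.

Section trajectory.
Context (R : realType) (H : completeNormedModType R) (dot : {dot H for idfun}).
Context (phi : H -> \bar R) (psi : H -> R) (dpsi : H -> H).
Context (hdot : induces_norm dot) (phi_proper : proper_fun phi).
Context (psi_convex : convex_function [set: convex_lmodType H] psi).
Context (psi_grad : is_gradient dot psi dpsi).
Context (bounded : bounded_below (esum_fun phi psi)).
Context (L : R) (L_ge0 : 0 <= L) (dpsi_lip : L.-lipschitz dpsi).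
Context (T c0 : R) (T_gt0 : 0 < T) (c0_gt0 : 0 < c0) (lambda : R -> R).
Context (lambda_ge : forall t : R, t \in `[0, T] -> c0 <= lambda t).
Context (x0 v0 : H) (x v : R -> H).
Context (sol : strong_solution dot phi dpsi T lambda x0 v0 x v).

Let incl t : 0 <= t -> t <= T -> subdiff dot phi (x t) (v t).
Proof. by move=> t0 tT; apply: (strong_solution_incl sol); rewrite in_itv/= t0. Qed.

Let initx : x 0 = x0. Proof. exact: strong_solution_x0 sol. Qed.
Let initv : v 0 = v0. Proof. exact: strong_solution_v0 sol. Qed.
Let acx : absolutely_continuous 0 T x. Proof. exact: strong_solution_acx sol. Qed.
Let acv : absolutely_continuous 0 T v. Proof. exact: strong_solution_acv sol. Qed.

(** Pass to the limit in the monotonicity inequality between x (t + h), x t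
    and the corresponding subgradients. *)
Lemma velocity_monotone t : 0 < t < T -> derivable x t 1 -> derivable v t 1 ->
  0 <= dot (x^`()%classic t) (v^`()%classic t).
Proof.
move=> /andP[t0 tT] /derivable_right_quotient dx /derivable_right_quotient dv.
apply: (ler_cvg_to (cvg_cst 0) (cvg_dot hdot _ dx dv)).
near=> h.
have h0 : 0 < h by near: h; exact: nbhs_right_gt.
have hT : h + t <= T.
  rewrite -lerBrDr; near: h; apply: nbhs_right_le; rewrite subr_gt0//.
rewrite /cst dotZl dotZr mulrA mulr_ge0 ?mulr_ge0 ?invr_ge0 ?(ltW h0)//.
apply: (subdiff_monotone phi_proper); apply: incl => //; lra.
Unshelve. all: by end_near. Qed.

Lemma velocity_ode :
  {ae lebesgue_measure, forall t : R, 0 < t < T ->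
    [/\ derivable x t 1, derivable v t 1,
     lambda t *: x^`()%classic t + v^`()%classic t + v t + dpsi (x t) = 0 &
     0 <= dot (x^`()%classic t) (v^`()%classic t)]}.
Proof.
apply: filterS (strong_solution_ode sol) => t ode t0T.
have [|dx dv e] := ode _; first by rewrite in_itv/=; case/andP: t0T => *; rewrite !ltW.
by split => //; exact: velocity_monotone.
Qed.

Let gap := energy_gap (esum_fun phi psi) x0.
Let en t := energy phi psi (x t).
Let p t := v t + dpsi (x t).

Let en_sub s t : 0 <= s -> s <= T -> 0 <= t -> t <= T ->
  en s + dot (p s) (x t - x s) <= en t.
Proof. by move=> *; apply: energy_subgradient (incl _ _) (incl _ _). Qed.

Lemma energy_gap_ge0 : 0 <= gap.
Proof.
have x0v := incl (lexx 0) (ltW T_gt0).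
have := energy_gap_ge phi_proper bounded x0v x0v.
by rewrite subrr initx.
Qed.

(** The subgradient inequality, read both ways, bounds the increments of the
    energy by those of x, because the subgradients are bounded on [0, T]. *)
Let ac_en : absolutely_continuous 0 T (en : R -> R^o).
Proof.
have acp : absolutely_continuous 0 T p.
  apply: (ac_dominated acv acx (M := 1 + L)) => [|s t _ _ _]; first by rewrite addr_ge0.
  rewrite /p opprD addrACA (le_trans (ler_normD _ _))//.
  have := lipschitz_norm (x t) (x s) dpsi_lip.
  have := mulr_ge0 L_ge0 (normr_ge0 (v t - v s)).
  have := normr_ge0 (x t - x s); lra.
have [M M0 pM] := ac_bounded acp (ltW T_gt0).
apply: (ac_dominated acx acx M0) => s t s0 st tT.
have t0 := le_trans s0 st; have sT := le_trans st tT.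
have h1 := en_sub s0 sT t0 tT; have h2 := en_sub t0 tT s0 sT.
have d1 : dot (p s) (x s - x t) <= M * `|x t - x s|.
  rewrite distrC (le_trans (dot_le_norm hdot _ _))// ler_wpM2r// pM//.
have d2 : dot (p t) (x t - x s) <= M * `|x t - x s|.
  by rewrite (le_trans (dot_le_norm hdot _ _))// ler_wpM2r// pM.
move: h1 h2; rewrite -(opprB (x s)) dotNr => h1 h2.
move: d2; rewrite -(opprB (x s)) dotNr normrN => d2.
have := mulr_ge0 M0 (normr_ge0 (x s - x t)) => h3.
move: d1; rewrite distrC => d1.
by rewrite ler_norml; apply/andP; split; lra.
Qed.

(** This is the Cauchy-Schwarz bound of the length of x by the square root
    of T times the integral of |x'|^2, the latter being at most gap / c0.
    Using Young's inequality under the derivative avoids integrating |x'|^2. *)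
Lemma displacement_bound t : 0 <= t -> t <= T ->
  `|x t - x0| <= Num.sqrt (T * (gap / c0)).
Proof.
move=> t0 tT; apply: le_sqrt_young => //.
  by rewrite divr_ge0 ?energy_gap_ge0// ltW.
(* By Young, |x'| <= 1 / (2 s) + s |x'|^2 / 2, and the energy decreases at rate
   at least c0 |x'|^2; hence F below is nonincreasing. *)
move=> s s0; pose k := s / (2 * c0); pose m := (2 * s)^-1.
have k0 : 0 <= k by rewrite divr_ge0 ?mulr_ge0// ltW.
have m0 : 0 <= m by rewrite invr_ge0 mulr_ge0// ltW.
pose F r := `|x r - x0| - r * m + k * en r.
have acF : absolutely_continuous 0 T (F : R -> R^o).
  apply: (@acD _ R^o _ _ (fun r => `|x r - x0| - r * m) (fun r => k * en r)).
    apply: (@acB _ R^o _ _ (fun r => `|x r - x0|) (fun r => r * m)).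
      apply: (ac_dominated acx acx ler01) => u w _ _ _.
      rewrite mul1r (le_trans (ler_dist_dist _ _))// opprB addrA subrK.
      by rewrite lerDl.
    apply: (ac_lipschitz m0) => u w _ uw _.
    by rewrite -mulrBl normrM mulrC !ger0_norm// subr_ge0.
  apply: (ac_dominated ac_en ac_en k0) => u w _ _ _.
  by rewrite -mulrBr normrM ger0_norm// ler_wpM2l// lerDl.
have : F t <= F 0.
  apply: (ac_nonincreasing acF) => //.
  apply: filterS velocity_ode => r H0 r0T; have [dx dv ode mon] := H0 r0T => dF.
  have [r0 rT] : 0 < r /\ r < T by case/andP: r0T.
  have dxr := derivable_right_quotient dx.
  have pr : p (h + r) @[h --> 0^'+] --> p r.
    apply: cvgD; first exact: derivable_right_cvg.
    by apply: lipschitz_cvg dpsi_lip _; exact: derivable_right_cvg.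
  pose X := `|x^`()%classic r|.
  apply: (@le_trans _ _ (X - m + k * dot (p r) (x^`()%classic r))).
    pose q h := h^-1 *: (x (h + r) - x r).
    apply: (derive_right_le dF (g := fun h =>
      `|q h| - m + k * dot (p (h + r)) (q h))).
      apply: cvgD; first by apply: cvgB; [exact: cvg_norm|exact: cvg_cst].
      by apply: cvgM; [exact: cvg_cst|exact: cvg_dot].
    near=> h.
    have h0 : 0 < h by near: h; exact: nbhs_right_gt.
    have hT : h + r <= T.
      by rewrite -lerBrDr; near: h; apply: nbhs_right_le; rewrite subr_gt0.
    rewrite /= mulrC ler_pdivrMr//; pose y := x (h + r) - x r.
    have qh : `|q h| * h = `|y|.
      by rewrite normrZ gtr0_norm ?invr_gt0// mulrAC mulVf ?mul1r ?gt_eqF.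
    have dh : dot (p (h + r)) (q h) * h = dot (p (h + r)) y.
      by rewrite dotZr mulrAC mulVf ?mul1r ?gt_eqF.
    have e1 : `|x (h + r) - x0| - `|x r - x0| <= `|y|.
      rewrite (le_trans (ler_norm _))// (le_trans (ler_dist_dist _ _))//.
      by rewrite opprB addrA subrK.
    have e2 : k * (en (h + r) - en r) <= k * dot (p (h + r)) y.
      rewrite ler_wpM2l//; have := @en_sub (h + r) r.
      by rewrite -(opprB (x (h + r))) dotNr -/y => H1; have := H1 _ _ _ _; lra.
    rewrite mulrDl mulrBl qh -mulrA dh /F; lra.
  have dpX : dot (p r) (x^`()%classic r) <= - (c0 * X ^+ 2).
    have -> : p r = - (lambda r *: x^`()%classic r + v^`()%classic r).
      by apply/eqP; rewrite -addr_eq0 /p addrC addrA; exact/eqP.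
    rewrite dotNl dotDl dotZl dot_norm// -/X lerN2 (dotC _ (v^`()%classic r)).
    have : c0 * X ^+ 2 <= lambda r * X ^+ 2.
      rewrite ler_wpM2r ?sqr_ge0// lambda_ge// in_itv/=.
      by case/andP: r0T => *; rewrite !ltW.
    lra.
  (* What remains is (s |x'| - 1)^2 / (2 s) >= 0. *)
  have := ler_wpM2l k0 dpX.
  have -> : k * - (c0 * X ^+ 2) = - (s * X ^+ 2 / 2).
    by rewrite /k; field; rewrite gt_eqF.
  have : 0 <= (s * X - 1) ^+ 2 * m by rewrite mulr_ge0// sqr_ge0.
  have -> : (s * X - 1) ^+ 2 * m = s * X ^+ 2 / 2 - X + m.
    by rewrite /m; field; rewrite gt_eqF.
  lra.
rewrite /F initx subrr normr0 mul0r subrr add0r => Ft.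
have en0 : en 0 - en t <= gap.
  rewrite /gap -initx.
  exact: (energy_gap_ge phi_proper bounded (incl (lexx 0) (ltW T_gt0)) (incl t0 tT)).
have := ler_wpM2l k0 en0; have : t * m <= T * m by rewrite ler_wpM2r.
have -> : T / (2 * s) = T * m by [].
have -> : gap / c0 * s / 2 = k * gap by rewrite /k; field; rewrite gt_eqF.
lra.
Unshelve. all: by end_near. Qed.

Let M := `|dpsi x0| + L * Num.sqrt (T * (gap / c0)).

Let M0 : 0 <= M.
Proof. by rewrite addr_ge0// mulr_ge0// sqrtr_ge0. Qed.

Lemma gradient_bound t : 0 <= t -> t <= T -> `|dpsi (x t)| <= M.
Proof.
move=> t0 tT; rewrite -[dpsi (x t)](subrK (dpsi x0)) addrC.
rewrite (le_trans (ler_normD _ _))// lerD2l.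
by rewrite (le_trans (lipschitz_norm _ _ dpsi_lip))// ler_wpM2l// displacement_bound.
Qed.

(** Here |v|^2 - 2 M^2 t is nonincreasing. *)
Lemma multiplier_bound t : 0 <= t -> t <= T ->
  `|v t| <= `|v0| + Num.sqrt (2 * T) * M.
Proof.
(* The equation tested against v' gives <v, v'> <= M |v'| - |v'|^2 <= M^2. *)
move=> t0 tT; pose G r := `|v r| ^+ 2 - 2 * M ^+ 2 * r.
have acG : absolutely_continuous 0 T (G : R -> R^o).
  apply: (@acB _ R^o _ _ (fun r => `|v r| ^+ 2) (fun r => 2 * M ^+ 2 * r)).
    have [B B0 vB] := ac_bounded acv (ltW T_gt0).
    apply: (ac_dominated acv acv B0) => u w u0 uw wT.
    have hu := vB u u0 (le_trans uw wT); have hw := vB w (le_trans u0 uw) wT.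
    have -> : `|v w| ^+ 2 - `|v u| ^+ 2 = (`|v w| + `|v u|) * (`|v w| - `|v u|) by ring.
    rewrite normrM (ger0_norm (_ : 0 <= `|v w| + `|v u|)) ?addr_ge0//.
    apply: (@le_trans _ _ ((B + B) * `|v w - v u|)); last by rewrite mulrDr mulrDl.
    by rewrite ler_pM ?addr_ge0// ?lerD// ler_dist_dist.
  have c2 : 0 <= 2 * M ^+ 2 by rewrite mulr_ge0// sqr_ge0.
  by apply: (ac_lipschitz c2) => u w _ uw _;
    rewrite -mulrBr ger0_norm// mulr_ge0// subr_ge0.
have : G t <= G 0.
  apply: (ac_nonincreasing acG) => //.
  apply: filterS velocity_ode => r H0 r0T; have [dx dv ode mon] := H0 r0T => dG.
  have [r0 rT] : 0 < r /\ r < T by case/andP: r0T.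
  set v' := v^`()%classic r in ode mon *; set x' := x^`()%classic r in ode mon *.
  apply: (@le_trans _ _ (dot (v r + v r) v' - 2 * M ^+ 2)).
    pose q h := h^-1 *: (v (h + r) - v r).
    apply: (derive_right_le dG (g := fun h =>
      dot (v (h + r) + v r) (q h) - 2 * M ^+ 2)).
      apply: cvgB; last exact: cvg_cst.
      apply: cvg_dot => //; last exact: derivable_right_quotient.
      by apply: cvgD; [exact: derivable_right_cvg|exact: cvg_cst].
    near=> h.
    have h0 : 0 < h by near: h; exact: nbhs_right_gt.
    rewrite mulrC ler_pdivrMr// mulrBl /q dotZr mulrAC mulVf ?mul1r ?gt_eqF//.
    rewrite dotDl !dotDr !dotNr !dot_norm// (dotC _ (v r)) /G; lra.
  have gb := gradient_bound (ltW r0) (ltW rT).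
  have lam : 0 <= lambda r * dot x' v'.
    by rewrite mulr_ge0// (le_trans (ltW c0_gt0))// lambda_ge// in_itv/= !ltW.
  have : dot (lambda r *: x' + v' + v r + dpsi (x r)) v' = 0.
    by rewrite ode -(scale0r 0) dotZl mul0r.
  rewrite !dotDl dotZl dot_norm// => e0.
  have := dot_le_norm hdot (- dpsi (x r)) v'; rewrite dotNl normrN => cs.
  have : `|dpsi (x r)| * `|v'| <= M * `|v'| by rewrite ler_wpM2r.
  have : 0 <= (`|v'| - M / 2) ^+ 2 by exact: sqr_ge0.
  have -> : (`|v'| - M / 2) ^+ 2 = `|v'| ^+ 2 - M * `|v'| + M ^+ 2 / 4 by field.
  have := sqr_ge0 M; lra.
rewrite /G initv mulr0 subr0 => Gt.
have sT0 : 0 <= Num.sqrt (2 * T) by exact: sqrtr_ge0.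
rewrite -ler_sqr ?nnegrE ?addr_ge0 ?mulr_ge0// sqrrD exprMn sqr_sqrtr; last first.
  by rewrite mulr_ge0// ltW.
have : M ^+ 2 * t <= M ^+ 2 * T by rewrite ler_wpM2l// sqr_ge0.
have : 0 <= `|v0| * (Num.sqrt (2 * T) * M) *+ 2 by rewrite mulrn_wge0// !mulr_ge0.
lra.
Unshelve. all: by end_near. Qed.

(** Monotonicity makes the velocity a part of v + grad psi x: lambda^2
    |x'|^2 <= |lambda x' + v'|^2 = |v + grad psi x|^2. *)
Lemma velocity_bound : {ae lebesgue_measure, forall t : R, 0 < t < T ->
  `|x^`()%classic t| <= `|v0| / c0 + (1 + Num.sqrt (2 * T)) / c0 * `|dpsi x0|
     + (Num.sqrt 2 * T + Num.sqrt T) * L / (c0 `^ (3 / 2)) * Num.sqrt gap}.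
Proof.
apply: filterS velocity_ode => t H0 t0T; have [dx dv ode mon] := H0 t0T.
have [t0 tT] : 0 <= t /\ t <= T by case/andP: t0T => *; rewrite !ltW.
set v' := v^`()%classic t in ode mon *; set x' := x^`()%classic t in ode mon *.
have lam : c0 <= lambda t by rewrite lambda_ge// in_itv/= t0.
(* Expand |lambda x' + v'|^2; the cross term is nonnegative. *)
have cx : c0 * `|x'| <= `|v t + dpsi (x t)|.
  have -> : v t + dpsi (x t) = - (lambda t *: x' + v').
    by apply/eqP; rewrite -addr_eq0 addrC addrA; exact/eqP.
  have c0x : 0 <= c0 * `|x'| by rewrite mulr_ge0// ltW.
  rewrite normrN -ler_sqr ?nnegrE// (normD_sqr hdot) dotZl normrZ.
  have lxx : c0 * `|x'| <= `|lambda t| * `|x'|.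
    by rewrite ler_wpM2r// (le_trans lam)// ler_norm.
  have : (c0 * `|x'|) ^+ 2 <= (`|lambda t| * `|x'|) ^+ 2.
    by rewrite lerXn2r// ?nnegrE// (le_trans c0x).
  have : 0 <= 2 * (lambda t * dot x' v').
    by rewrite !mulr_ge0// (le_trans (ltW c0_gt0)).
  have := sqr_ge0 `|v'|; lra.
have vb := multiplier_bound t0 tT; have gb := gradient_bound t0 tT.
have {cx} : `|x'| <= (`|v0| + Num.sqrt (2 * T) * M + M) / c0.
  rewrite ler_pdivlMr// mulrC (le_trans cx)// (le_trans (ler_normD _ _))//.
  exact: lerD.
move/le_trans; apply; rewrite le_eqVlt; apply/orP; left; apply/eqP.
have c00 : c0 != 0 by rewrite gt_eqF.
have -> : c0 `^ (3 / 2) = c0 * Num.sqrt c0.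
  rewrite -powR12_sqrt ?ltW// -{2}[c0]powRr1 ?ltW// -powRD; last by rewrite c00 implybT.
  by congr (_ `^ _); field.
have gap0 := energy_gap_ge0.
have -> : Num.sqrt (2 * T) = Num.sqrt 2 * Num.sqrt T by rewrite sqrtrM.
have DE : Num.sqrt (T * (gap / c0)) = Num.sqrt T * (Num.sqrt gap / Num.sqrt c0).
  by rewrite sqrtrM ?(ltW T_gt0)// sqrtrM// sqrtrV// ltW.
rewrite /M DE.
have sc : Num.sqrt c0 != 0 by rewrite gt_eqF// sqrtr_gt0.
have TE : Num.sqrt T ^+ 2 = T by rewrite sqr_sqrtr// ltW.
set sT := Num.sqrt T in TE *; rewrite -TE.
by field; rewrite sc c00.
Qed.

End trajectory.

(** * Comparison of two trajectories *)

Section stability.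
Context (R : realType) (H : completeNormedModType R) (dot : {dot H for idfun}).
Context (phi : H -> \bar R) (psi : H -> R) (dpsi : H -> H).
Context (hdot : induces_norm dot) (phi_proper : proper_fun phi).
Context (psi_convex : convex_function [set: convex_lmodType H] psi).
Context (psi_grad : is_gradient dot psi dpsi).
Context (bounded : bounded_below (esum_fun phi psi)).
Context (L : R) (L_ge0 : 0 <= L) (dpsi_lip : L.-lipschitz dpsi).
Context (T c0 : R) (T_gt0 : 0 < T) (c0_gt0 : 0 < c0) (lambda eta : R -> R).
Context (lambda_ge : forall t : R, t \in `[0, T] -> c0 <= lambda t).
Context (eta_ge : forall t : R, t \in `[0, T] -> c0 <= eta t).
Context (lambda_ac : absolutely_continuous 0 T (lambda : R -> R^o)).
Context (eta_ac : absolutely_continuous 0 T (eta : R -> R^o)).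
Context (x0 y0 v0 w0 : H) (x v y w : R -> H).
Context (solx : strong_solution dot phi dpsi T lambda x0 v0 x v).
Context (soly : strong_solution dot phi dpsi T eta y0 w0 y w).

(** sigma is 2 mu, and z is mu a + b, in the notation of the introduction. *)
Let sigma t := lambda t + eta t.
Let z t := (sigma t / 2) *: (x t - y t) + (v t - w t).

Let sigma_ac : absolutely_continuous 0 T (sigma : R -> R^o).
Proof. exact: (@acD _ R^o). Qed.

Let z_ac : absolutely_continuous 0 T z.
Proof.
apply: acD; last first.
  by apply: acB; [exact: strong_solution_acv solx|exact: strong_solution_acv soly].
apply: ac_scale (ltW T_gt0) _ _; last first.
  by apply: acB; [exact: strong_solution_acx solx|exact: strong_solution_acx soly].
have h0 : 0 <= 2^-1 :> R by rewrite invr_ge0.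
apply: (ac_dominated sigma_ac sigma_ac h0) => s t _ _ _.
by rewrite -mulrBl normrM mulrC (ger0_norm h0) ler_wpM2l// lerDl.
Qed.

(** The cross term of |z t|^2 is nonnegative by monotonicity of the
    subdifferential. *)
Lemma theta_le_norm t : 0 <= t -> t <= T ->
  Num.sqrt (c0 ^+ 2 * `|x t - y t| ^+ 2 + `|v t - w t| ^+ 2) <= `|z t|.
Proof.
move=> t0 tT; have tI : t \in `[0, T] by rewrite in_itv/= t0.
rewrite -[leRHS]ger0_norm// -sqrtr_sqr ler_sqrt ?sqr_ge0//.
have mu_ge : c0 <= sigma t / 2.
  by have := lambda_ge tI; have := eta_ge tI; rewrite /sigma; lra.
have mon := subdiff_monotone phi_proper (strong_solution_incl solx tI)
  (strong_solution_incl soly tI).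
rewrite /z (normD_sqr hdot (_ *: _)) dotZl normrZ.
have := mulr_ge0 (le_trans (ltW c0_gt0) mu_ge) mon.
have : c0 ^+ 2 * `|x t - y t| ^+ 2 <= (`|sigma t / 2| * `|x t - y t|) ^+ 2.
  by rewrite exprMn ler_wpM2r ?sqr_ge0//
    lerXn2r ?nnegrE ?(ltW c0_gt0)// (le_trans mu_ge)// ler_norm.
lra.
Qed.

Lemma norm_le_theta t : 0 <= t -> t <= T ->
  c0 * `|x t - y t| <= `|z t| /\ `|v t - w t| <= `|z t|.
Proof.
move=> t0 tT; have := theta_le_norm t0 tT.
set A := c0 ^+ 2 * _; set B := `|v t - w t| ^+ 2 => h.
have A0 : 0 <= A by rewrite mulr_ge0 ?sqr_ge0.
have B0 : 0 <= B by rewrite sqr_ge0.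
have cx0 : 0 <= c0 * `|x t - y t| by rewrite mulr_ge0// ltW.
split; apply: le_trans h.
  by rewrite -[leLHS]ger0_norm// -sqrtr_sqr ler_sqrt ?addr_ge0// exprMn lerDl.
by rewrite -[leLHS]ger0_norm// -sqrtr_sqr ler_sqrt ?addr_ge0// lerDr.
Qed.

(** The bound of [velocity_bound], for the initial point u0 and the initial
    subgradient p0. *)
Let speed (u0 p0 : H) := `|p0| / c0 + (1 + Num.sqrt (2 * T)) / c0 * `|dpsi u0|
   + (Num.sqrt 2 * T + Num.sqrt T) * L / (c0 `^ (3 / 2))
     * Num.sqrt (energy_gap (esum_fun phi psi) u0).
Let C := speed x0 v0 + speed y0 w0.

Lemma norm_derive_le :
  {ae lebesgue_measure, forall t, 0 < t < T ->
    derivable ((fun s => `|z s|) : R -> R^o) t 1 ->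
    (fun s => `|z s|)^`()%classic t <=
      (`|sigma^`()%classic t| / (2 * c0) + (1 + L / c0)) * `|z t|
      + C / 2 * `|lambda t - eta t|}.
Proof.
have odex := velocity_ode hdot phi_proper solx.
have odey := velocity_ode hdot phi_proper soly.
have spx := velocity_bound hdot phi_proper psi_convex psi_grad bounded L_ge0
  dpsi_lip T_gt0 c0_gt0 lambda_ge solx.
have spy := velocity_bound hdot phi_proper psi_convex psi_grad bounded L_ge0
  dpsi_lip T_gt0 c0_gt0 eta_ge soly.
have dsig := ac_derivable (ltW T_gt0) sigma_ac.
apply: filterS3 (filterI odex odey) (filterI spx spy) dsig.
move=> t [H1 H2] [H3 H4] H5 t0T du.
have {H1}[dx dv ex _] := H1 t0T; have {H2}[dy dw ey _] := H2 t0T.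
have {}H3 := H3 t0T; have {}H4 := H4 t0T; have {}H5 := H5 t0T.
have [t0 tT] : 0 <= t /\ t <= T by case/andP: t0T => *; rewrite !ltW.
set x' := x^`()%classic t in ex H3; set v' := v^`()%classic t in ex.
set y' := y^`()%classic t in ey H4; set w' := w^`()%classic t in ey.
set s' := sigma^`()%classic t.
(* The product rule, written out, gives z' as the derivative of z; the two
   equations then eliminate v' and w'. *)
pose z' := (sigma t / 2) *: (x' - y') + (s' / 2) *: (x t - y t) + (v' - w').
have z'E : z' = (s' / 2) *: (x t - y t) - ((lambda t - eta t) / 2) *: (x' + y')
   - (v t - w t) - (dpsi (x t) - dpsi (y t)).
  apply: (dot_ext hdot) => h.
  have dot0 : dot 0 h = 0 by rewrite -(scale0r 0) dotZl mul0r.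
  move: (congr1 (dot^~ h) ex) (congr1 (dot^~ h) ey) => /=; rewrite dot0.
  rewrite /z' /sigma !(dotDl, dotNl, dotZl); lra.
have [xz vz] := norm_le_theta t0 tT.
have {}xz : `|x t - y t| <= `|z t| / c0 by rewrite ler_pdivlMr// mulrC.
have le_z' : (fun s => `|z s|)^`()%classic t <= `|z'|.
  pose q (f : R -> H) h := h^-1 *: (f (h + t) - f t).
  apply: (derive_right_le du (g := fun h => `|q z h|)).
    apply: cvg_norm.
    have -> : q z = fun h => (sigma (h + t) / 2) *: (q x h - q y h) +
        ((h^-1 *: (sigma (h + t) - sigma t)) / 2) *: (x t - y t) + (q v h - q w h).
      apply/funext => h; apply: (dot_ext hdot) => u; rewrite /q /z.
      rewrite !(dotDl, dotNl, dotZl) /GRing.scale/=; ring.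
    apply: cvgD; first apply: cvgD.
    - apply: cvgZ.
        by apply: cvgM; [exact: derivable_right_cvg|exact: cvg_cst].
      by apply: cvgB; exact: derivable_right_quotient.
    - apply: cvgZ; last exact: cvg_cst.
      by apply: cvgM; [exact: derivable_right_quotient|exact: cvg_cst].
    - by apply: cvgB; exact: derivable_right_quotient.
  near=> h.
  have h0 : 0 < h by near: h; exact: nbhs_right_gt.
  rewrite /q normrZ gtr0_norm ?invr_gt0// ler_pM2l ?invr_gt0//.
  by rewrite (le_trans (ler_norm _))// ler_dist_dist.
apply: (le_trans le_z').
rewrite z'E.
have lip := lipschitz_norm (x t) (y t) dpsi_lip.
have n1 : `|(s' / 2) *: (x t - y t)| <= `|s'| / (2 * c0) * `|z t|.
  have -> : `|s'| / (2 * c0) * `|z t| = `|s'| / 2 * (`|z t| / c0).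
    by field; rewrite gt_eqF.
  by rewrite normrZ normrM (gtr0_norm (_ : 0 < 2^-1)) ?invr_gt0// ler_wpM2l.
have n2 : `|((lambda t - eta t) / 2) *: (x' + y')| <= C / 2 * `|lambda t - eta t|.
  rewrite normrZ normrM (gtr0_norm (_ : 0 < 2^-1)) ?invr_gt0//.
  have -> : C / 2 * `|lambda t - eta t| = `|lambda t - eta t| / 2 * C by ring.
  by rewrite ler_wpM2l// (le_trans (ler_normD _ _))// lerD.
have n3 : `|dpsi (x t) - dpsi (y t)| <= L / c0 * `|z t|.
  by rewrite (le_trans lip)// -mulrA (mulrC c0^-1) ler_wpM2l.
rewrite (le_trans (ler_normB _ _))//.
have := ler_normB
  ((s' / 2) *: (x t - y t) - ((lambda t - eta t) / 2) *: (x' + y')) (v t - w t).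
have := ler_normB ((s' / 2) *: (x t - y t)) (((lambda t - eta t) / 2) *: (x' + y')).
lra.
Unshelve. all: by end_near. Qed.

Let speed_ge0 u0 p0 : 0 <= speed u0 p0.
Proof.
have c := ltW c0_gt0; have tt := ltW T_gt0.
by rewrite /speed !addr_ge0// ?mulr_ge0 ?addr_ge0 ?invr_ge0
  ?mulr_ge0 ?sqrtr_ge0 ?powR_ge0.
Qed.

(** Gronwall's lemma for |z|, the exponent being V / (2 c0) + t (1 + L / c0)
    with V the variation function of lambda + eta. *)
Lemma stability_bound t : 0 <= t -> t <= T ->
  Num.sqrt (c0 ^+ 2 * `|x t - y t| ^+ 2 + `|v t - w t| ^+ 2) <=
  ((lambda 0 + eta 0) / 2 * `|x0 - y0| + `|v0 - w0|
    + C / 2 * \int[lebesgue_measure]_(s in `]0, T]) `|lambda s - eta s|)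
  * expR (fine (total_variation 0 T sigma) / (2 * c0) + T * (1 + L / c0)).
Proof.
move=> t0 tT; apply: (le_trans (theta_le_norm t0 tT)).
have T0 := ltW T_gt0; have c0' := ltW c0_gt0.
have bv := ac_bounded_variation sigma_ac T0.
pose V s := fine (total_variation 0 s sigma).
have acV : absolutely_continuous 0 T (V : R -> R^o) by exact: ac_total_variation.
pose K s := V s / (2 * c0) + s * (1 + L / c0).
have k1 : 0 <= (2 * c0)^-1 by rewrite invr_ge0 mulr_ge0.
have k2 : 0 <= 1 + L / c0 by rewrite addr_ge0// divr_ge0.
have Vnd r s : 0 <= r -> r <= s -> s <= T -> V r <= V s.
  move=> r0 rs sT; rewrite -subr_ge0.
  by apply: le_trans (total_variation_increment bv r0 rs sT).
have acK : absolutely_continuous 0 T (K : R -> R^o).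
  apply: (@acD _ R^o _ _ (fun s => V s / (2 * c0)) (fun s => s * (1 + L / c0))).
    apply: (ac_dominated acV acV k1) => r s _ _ _.
    by rewrite -mulrBl normrM mulrC (ger0_norm k1) ler_wpM2l// lerDl.
  apply: (ac_lipschitz k2) => r s _ rs _.
  by rewrite -mulrBl normrM mulrC !ger0_norm// subr_ge0.
have ac_u := ac_norm z_ac.
have ac_diff : absolutely_continuous 0 T ((fun s => `|lambda s - eta s|) : R -> R^o).
  by apply: (@ac_norm _ R^o); apply: (@acB _ R^o).
have int_diff : lebesgue_measure.-integrable `]0, T]
    (EFin \o (fun s => `|lambda s - eta s|)).
  have := ac_integrable ac_diff T0; apply: integrableS => //.
  exact: subset_itv_oc_cc.
have C0 : 0 <= C by rewrite addr_ge0.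
have z0 : `|z 0| <= (lambda 0 + eta 0) / 2 * `|x0 - y0| + `|v0 - w0|.
  rewrite /z (strong_solution_x0 solx) (strong_solution_v0 solx).
  rewrite (strong_solution_x0 soly) (strong_solution_v0 soly).
  rewrite (le_trans (ler_normD _ _))// normrZ ger0_norm//.
  have I0 : (0 : R) \in `[0, T] by rewrite in_itv/= lexx.
  rewrite divr_ge0// addr_ge0//.
    exact: le_trans (lambda_ge I0).
  exact: le_trans (eta_ge I0).
have KT : K T = fine (total_variation 0 T sigma) / (2 * c0) + T * (1 + L / c0) by [].
have intg : lebesgue_measure.-integrable `]0, T]
    (EFin \o (fun s => C / 2 * `|lambda s - eta s|)).
  have : lebesgue_measure.-integrable `]0, T]
      (fun s : R => (C / 2)%:E * (`|lambda s - eta s|%R)%:E)%E.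
    by apply: integrableZl => //; exact: measurable_itv.
  exact.
have intE : \int[lebesgue_measure]_(s in `]0, T]) (C / 2 * `|lambda s - eta s|) =
    C / 2 * \int[lebesgue_measure]_(s in `]0, T]) `|lambda s - eta s|.
  by rewrite RintegralZl.
have : `|z t| <= (`|z 0| +
    \int[lebesgue_measure]_(s in `]0, T]) (C / 2 * `|lambda s - eta s|))
    * expR (K T).
  apply: (ac_gronwall T0 ac_u acK) => //.
  - by rewrite /K /V total_variationxx/= !mul0r addr0.
  - move=> r s r0 rs sT; rewrite /K lerD//.
      by rewrite ler_wpM2r// Vnd.
    by rewrite ler_wpM2r.
  - by move=> s; rewrite mulr_ge0// divr_ge0.
  have dsig := ac_derivable T0 sigma_ac; have dV := ac_derivable T0 acV.
  apply: filterS3 norm_derive_le dsig dV => s H1 H2 H3 s0T du dK.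
  have {}H1 := H1 s0T du; have {}H2 := H2 s0T; have {}H3 := H3 s0T.
  apply: (le_trans H1); rewrite lerD2r ler_wpM2r//.
  have -> : K^`()%classic s = V^`()%classic s / (2 * c0) + (1 + L / c0).
    have -> : K = (2 * c0)^-1 \*: (V : R -> R^o) + (1 + L / c0) \*: (@idfun R^o).
      by apply/funext => r; rewrite /K mulrC [X in _ + X]mulrC.
    have iK := is_deriveD (is_deriveZ (2 * c0)^-1 (is_derive_derive1 H3))
      (is_deriveZ (1 + L / c0) (is_derive_id (s : R^o) 1)).
    by rewrite derive1E (derive_val (is_derive := iK)) /GRing.scale/= mulr1 mulrC.
  rewrite lerD2r ler_wpM2r//.
  case/andP: s0T => s0 sT.
  exact: derive1_norm_le_total_variation bv s0 sT H2 H3.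
move/le_trans; apply; rewrite KT intE ler_wpM2r ?expR_ge0//.
by rewrite lerD2r.
Qed.

End stability.

(** * Norms on [0, T] and conclusion *)

Lemma Lnorm_itv1 (R : realType) (T : R) (f : R -> R) :
  Lnorm_itv T 1 f = (\int[lebesgue_measure]_(z in `[0%R, T]) `|f z|%:E)%E.
Proof.
rewrite /Lnorm_itv Lnorm1 [RHS]integral_mkcond; apply: eq_integral => z _.
by rewrite !patchE; case: ifP => //= _; rewrite normr0.
Qed.

Lemma Lnorm_itvy_le (R : realType) (T r : R) (f : R -> R) : 0 <= r ->
  (forall t, 0 <= t -> t <= T -> `|f t| <= r) -> (Lnorm_itv T +oo f <= r%:E)%E.
Proof.
move=> r0 fr; rewrite /Lnorm_itv unlock; case: ifP => _; last by rewrite lee_fin.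
apply/ess_sup_inf.ess_supP; apply: nearW => t /=.
rewrite patchE; case: ifPn => [|_]; last by rewrite abse0 lee_fin.
by rewrite inE/= in_itv/= => /andP[t0 tT]; rewrite lee_fin fr.
Qed.

Theorem theorem3p1 (R : realType) (H : completeNormedModType R)
  (dot : {dot H for idfun}) (hdot : induces_norm dot)
  (phi : H -> \bar R) (phi_convex : econvex phi)
  (phi_lsc : lower_semicontinuous phi) (phi_proper : proper_fun phi)
  (psi : H -> R) (dpsi : H -> H)
  (psi_convex : convex_function [set: convex_lmodType H] psi)
  (psi_grad : is_gradient dot psi dpsi)
  (L : R) (L_ge0 : 0 <= L) (dpsi_lip : L.-lipschitz dpsi)
  (bounded : bounded_below (esum_fun phi psi))
  (T c0 : R) (T_gt0 : 0 < T) (c0_gt0 : 0 < c0)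
  (lambda eta : R -> R)
  (lambda_ge : forall t : R, t \in `[0, T] -> c0 <= lambda t)
  (eta_ge : forall t : R, t \in `[0, T] -> c0 <= eta t)
  (lambda_ac : absolutely_continuous 0 T lambda)
  (eta_ac : absolutely_continuous 0 T eta)
  (x0 y0 v0 w0 : H)
  (hx0 : dom_subdiff dot phi x0) (hy0 : dom_subdiff dot phi y0)
  (hv0 : subdiff dot phi x0 v0) (hw0 : subdiff dot phi y0 w0)
  (x v y w : R -> H)
  (hxv : strong_solution dot phi dpsi T lambda x0 v0 x v)
  (hyw : strong_solution dot phi dpsi T eta y0 w0 y w) :
  let theta := fun t : R =>
    Num.sqrt (c0 ^+ 2 * `|x t - y t| ^+ 2 + `|v t - w t| ^+ 2) in
  let gap := energy_gap (esum_fun phi psi) in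
  let growth := expeR
    (Lnorm_itv T 1 (fun t => lambda^`()%classic t + eta^`()%classic t)%R * ((2 * c0)^-1)%:E
      + (T * (1 + L / c0))%:E)%E in
  (let C := (`|v0| + `|w0|) / c0
     + (1 + Num.sqrt (2 * T)) / c0 * (`|dpsi x0| + `|dpsi y0|)
     + (Num.sqrt 2 * T + Num.sqrt T) * L / (c0 `^ (3 / 2))
       * (Num.sqrt (gap x0) + Num.sqrt (gap y0)) in
   (Lnorm_itv T +oo theta <=
     (((lambda 0 + eta 0) / 2 * `|x0 - y0| + `|v0 - w0|)%:E
        + (C / 2)%:E * Lnorm_itv T 1 (fun t => lambda t - eta t)%R)
     * growth)%E)
  /\
  (x0 = y0 -> v0 = w0 ->
   let C := 2 * `|v0| / c0
     + 2 * ((1 + Num.sqrt (2 * T)) / c0) * `|dpsi x0|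
     + 2 * ((Num.sqrt 2 * T + Num.sqrt T) * L / (c0 `^ (3 / 2)))
       * Num.sqrt (gap x0) in
   (Lnorm_itv T +oo theta <=
     (C / 2)%:E * Lnorm_itv T 1 (fun t => lambda t - eta t)%R * growth)%E).
Proof.
move=> theta gap growth.
have T0 := ltW T_gt0.
set N := Lnorm_itv T 1 (fun t => lambda t - eta t).
suff main C : C = (`|v0| + `|w0|) / c0
     + (1 + Num.sqrt (2 * T)) / c0 * (`|dpsi x0| + `|dpsi y0|)
     + (Num.sqrt 2 * T + Num.sqrt T) * L / (c0 `^ (3 / 2))
       * (Num.sqrt (gap x0) + Num.sqrt (gap y0)) ->
   (Lnorm_itv T +oo theta <=
     (((lambda 0 + eta 0) / 2 * `|x0 - y0| + `|v0 - w0|)%:E + (C / 2)%:E * N)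
     * growth)%E.
  split; first exact: main erefl.
  move=> x0y0 v0w0; lazy zeta; set C := (X in (X / 2)%:E); have := main C.
  rewrite -x0y0 -v0w0 !subrr !normr0 mulr0 addr0 add0e; apply.
  by rewrite /C; ring.
move=> CE; rewrite /N Lnorm_itv1.
pose sigma t := lambda t + eta t.
have ac_sigma : absolutely_continuous 0 T (sigma : R -> R^o) by exact: (@acD _ R^o).
have int_diff : lebesgue_measure.-integrable `[0, T] 
    (EFin \o (fun s => `|lambda s - eta s|)).
  by apply: ac_integrable => //; apply: (@ac_norm _ R^o); apply: (@acB _ R^o).
set I := (\int[_]_(_ in _) _)%E.
have Ifin : I \is a fin_num by exact: integrable_fin_num int_diff.
pose TV := fine (total_variation 0 T sigma).
have C0 : 0 <= C.
  by rewrite CE !addr_ge0 ?mulr_ge0 ?addr_ge0 ?invr_ge0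
     ?mulr_ge0 ?sqrtr_ge0 ?powR_ge0// ltW.
have bound t : 0 <= t -> t <= T -> theta t <=
    ((lambda 0 + eta 0) / 2 * `|x0 - y0| + `|v0 - w0| + C / 2 * fine I)
    * expR (TV / (2 * c0) + T * (1 + L / c0)).
  move=> t0 tT.
  apply: (le_trans (stability_bound hdot phi_proper psi_convex psi_grad bounded
    L_ge0 dpsi_lip T_gt0 c0_gt0 lambda_ge eta_ge lambda_ac eta_ac hxv hyw t0 tT)).
  rewrite ler_wpM2r ?expR_ge0// lerD2l.
  set S := (X in X / 2 * Rintegral _ _ _).
  have -> : S = C by rewrite CE /S /gap; ring.
  rewrite ler_wpM2l ?divr_ge0//.
  have sub : `]0, T] `<=` `[0, T] by exact: subset_itv_oc_cc.
  apply: fine_le => //.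
    apply: integrable_fin_num => //; apply: integrableS int_diff => //.
  by apply: ge0_subset_integral => //; exact: measurable_int int_diff.
have TVN : (TV%:E <=
    Lnorm_itv T 1 (fun t => lambda^`()%classic t + eta^`()%classic t)%R)%E.
  rewrite Lnorm_itv1 /TV fineK.
    apply: ac_total_variation_le => //.
    have dl := ac_derivable T0 lambda_ac; have de := ac_derivable T0 eta_ac.
    apply: filterS2 dl de => t H1 H2 /[dup] /H1 dlt /H2 det.
    by rewrite !derive1E (deriveD dlt det).
  by apply/bounded_variationP => //; exact: ac_bounded_variation.
apply: (@le_trans _ _ (((lambda 0 + eta 0) / 2 * `|x0 - y0| + `|v0 - w0| + C / 2 * fine I)
    * expR (TV / (2 * c0) + T * (1 + L / c0)))%:E).
  apply: Lnorm_itvy_le => [|t t0 tT]; last by rewrite ger0_norm ?sqrtr_ge0// bound.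
  by rewrite (le_trans _ (bound 0 _ _))// sqrtr_ge0.
have -> : (((lambda 0 + eta 0) / 2 * `|x0 - y0| + `|v0 - w0|)%:E + (C / 2)%:E * I)%E =
    ((lambda 0 + eta 0) / 2 * `|x0 - y0| + `|v0 - w0| + C / 2 * fine I)%:E.
  by rewrite [RHS]EFinD; congr (_ + _)%E; rewrite [RHS]EFinM fineK.
rewrite EFinM.
apply: lee_wpmul2l.
  have lt0 : 0 <= (lambda 0 + eta 0) / 2.
    have I0 : (0 : R) \in `[0, T] by rewrite in_itv/= lexx.
    by rewrite divr_ge0// addr_ge0// (le_trans (ltW c0_gt0)) ?lambda_ge ?eta_ge.
  have I_ge0 : 0 <= fine I by rewrite fine_ge0// integral_ge0.
  by rewrite lee_fin addr_ge0 ?addr_ge0// mulr_ge0// divr_ge0.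
rewrite /growth -[leLHS]/(expeR (_%:E)) lee_expeR EFinD.
by rewrite leeD2r// EFinM lee_wpmul2r// lee_fin invr_ge0 mulr_ge0// ltW.
Qed.
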